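(* Let $X$ be a Banach space. For every $1<p<\infty$, the Malliavin derivative $D$, defined on $X$-valued cylindrical functions (considered as a linear operator on those $F\in\mathscr{C}(\Omega;X)$ with $F\in L^p(\Omega;X)$ and $DF\in L^p(\Omega;\nu_p(E;X))$), is closable as an operator from $L^p(\Omega;X)$ into $L^p(\Omega;\nu_p(E;X))$.
   Context: Poisson random measure: $(\Omega,\mathcal{F},\mathbb{P})$ is a probability space, $(E,\mathcal{E})$ a measurable space, and $N$ is a Poisson random measure on $(E,\mathcal{E})$ with $\sigma$-finite intensity measure $\mu$, i.e. a map $N:\Omega\times\mathcal{E}\to\mathbb{N}\cup\{\infty\}$ such that $N(B)$ is a random variable for each $B\in\mathcal{E}$, $N(\omega,\cdot)$ is a measure for each $\omega$, $N(B)$ is Poisson distributed with parameter $\mu(B)$ ($N(B)=\infty$ a.s. if $\mu(B)=\infty$), and $N(B_1),\dots,N(B_n)$ are independent for pairwise disjoint $B_1,\dots,B_n$. Put $\mathcal{E}_\mu=\{B\in\mathcal{E}:\mu(B)<\infty\}$ and $\tilde N(B)=N(B)-\mu(B)$ for $B\in\mathcal{E}_\mu$. Poisson $p$-norm: for a simple function $f=\sum_{j=1}^m\mathbf 1_{B_j}\otimes x_j$ with $x_j\in X$ and pairwise disjoint $B_j\in\mathcal{E}_\mu$, let $\tilde N(f)=\sum_j\tilde N(B_j)x_j$ and $\|f\|_{\nu_p(E;X)}=(\mathbb{E}\|\tilde N(f)\|_X^p)^{1/p}$. $\nu_p(E;X)$ is the completion of the space of simple functions in this norm. Cylindrical functions: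 a (real) cylindrical function is a random variable $F=f(N(B_1),\dots,N(B_M))$ with $M\ge 1$, $f:\mathbb{N}^M\to\mathbb{R}$ ($0\in\mathbb{N}$) and $B_1,\dots,B_M\in\mathcal{E}_\mu$, which may always be taken pairwise disjoint. $\mathscr{C}(\Omega)$ is the vector space of these, and $\mathscr{C}(\Omega;X)=\mathscr{C}(\Omega)\otimes X$ consists of all $F=\sum_{i=1}^n F_i\otimes x_i$ with $F_i\in\mathscr{C}(\Omega)$, $x_i\in X$. Malliavin derivative: writing $F=\sum_{i=1}^n f_i(N(\mathbf{B}))\otimes x_i\in\mathscr{C}(\Omega;X)$ with $N(\mathbf{B})=(N(B_1),\dots,N(B_M))$, $B_1,\dots,B_M\in\mathcal{E}_\mu$ pairwise disjoint, and $\mathbf{e}_m$ the $m$-th unit vector of $\mathbb{R}^M$, $$DF=\sum_{i=1}^n\sum_{m=1}^M\big(f_i(N(\mathbf{B})+\mathbf{e}_m)-f_i(N(\mathbf{B}))\big)\otimes(\mathbf 1_{B_m}\otimes x_i),$$ a random variable with values in $L^2(E,\mu)\otimes X$, in fact in the $X$-valued simple functions on $E$; it does not depend on the representation. *)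

(* Defs.v *)
From HB Require Import structures.
From mathcomp Require Import all_boot all_order all_algebra.
From mathcomp Require Import all_classical all_reals all_analysis.
From mathcomp Require Import measurable_realfun.

Set Implicit Arguments.
Unset Strict Implicit.
Unset Printing Implicit Defensive.

Import Order.TTheory GRing.Theory Num.Theory.
Import numFieldNormedType.Exports.

Local Open Scope classical_set_scope.
Local Open Scope ring_scope.

(** * Bochner spaces L^p(Omega; V) and closability *)

Section bochner.
Context d (Omega : measurableType d) (R : realType).
Variable P : probability Omega R.

Definition strongly_measurable (V : normedModType R) (f : Omega -> V) :=
  exists s : nat -> {fimfun Omega >-> V},
    (forall n v, measurable (s n @^-1` [set v])) /\
    {ae P, forall w, s n w @[n --> \oo] --> f w}.

Definition bochner_norm (V : normedModType R) (p : R) (f : Omega -> V) :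
  \bar R := ('N[P]_(p%:E)[(fun w => `|f w|%:E)])%E.

Definition bochner_Lp (V : normedModType R) (p : R) (f : Omega -> V) :=
  strongly_measurable f /\ (bochner_norm p f < +oo)%E.

(** Elements of L^p are represented by functions; an operator from L^p(Omega; V)
    to L^p(Omega; W) is represented by its graph, saturated under almost sure
    equality. *)
Definition closable_Lp (V W : normedModType R) (p : R)
    (graph : (Omega -> V) -> (Omega -> W) -> Prop) :=
  forall (F : nat -> Omega -> V) (G : nat -> Omega -> W) (g : Omega -> W),
    (forall n, graph (F n) (G n)) ->
    bochner_Lp p g ->
    bochner_norm p (F n) @[n --> \oo] --> 0%E ->
    bochner_norm p (G n \- g) @[n --> \oo] --> 0%E ->
    {ae P, forall w, g w = 0}.

End bochner.

(** * Poisson random measures *)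

Section poisson.
Context d d' (Omega : measurableType d) (E : measurableType d') (R : realType).
Variables (P : probability Omega R) (mu : {measure set E -> \bar R}).
Variable N : R.-ker Omega ~> E.

(** That each [N ^~ B] is a random variable and each [N w] is a measure is part
    of [N] being a kernel.  The Poisson weights are written out because the
    library's [poisson_pmf] takes the value 1 everywhere when the rate is 0. *)
Definition poisson_random_measure :=
  [/\ forall w B, measurable B ->
        N w B = +oo%E \/ exists k : nat, N w B = k%:R%:E,
      forall B, measurable B -> (mu B < +oo)%E -> forall k : nat,
        P [set w | N w B = k%:R%:E] =
          (fine (mu B) ^+ k / k`!%:R * expR (- fine (mu B)))%:E,
      forall B, measurable B -> mu B = +oo%E -> P [set w | N w B = +oo%E] = 1%E
    & forall (n : nat) (B : 'I_n -> set E) (A : 'I_n -> set (\bar R)),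
        (forall i, measurable (B i)) -> trivIset setT B ->
        (forall i, measurable (A i)) ->
        P (\bigcap_i [set w | A i (N w (B i))]) =
          (\prod_(i < n) P [set w | A i (N w (B i))])%E].

(** [N w B] as a natural number; the junk value 0 on [N w B = +oo] only matters
    on a null set when [mu B] is finite. *)
Definition count (B : set E) (w : Omega) : nat := Num.truncn (fine (N w B)).

Definition compensated (B : set E) (w : Omega) : R :=
  fine (N w B) - fine (mu B).

Definition disjoint_finite (m : nat) (B : 'I_m -> set E) :=
  [/\ forall k, measurable (B k), forall k, (mu (B k) < +oo)%E
    & trivIset setT B].

Variable X : normedModType R.

Definition step (m : nat) (B : 'I_m -> set E) (x : 'I_m -> X) (e : E) : X :=
  \sum_(k < m) \1_(B k) e *: x k.

Definition simple_functions : set (E -> X) :=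
  [set f | exists m (B : 'I_m -> set E) (x : 'I_m -> X),
             disjoint_finite B /\ f = step B x].

Definition compensated_step (m : nat) (B : 'I_m -> set E) (x : 'I_m -> X)
    (w : Omega) : X :=
  \sum_(k < m) compensated (B k) w *: x k.

(** [V], with [j] as the canonical map from the simple functions, is the
    completion nu_p(E; X); the values of [j] off the simple functions are
    irrelevant.  Completeness is the structure of [V]. *)
Definition nu_completion (p : R) (V : completeNormedModType R)
    (j : (E -> X) -> V) :=
  [/\ {in simple_functions &, forall f g, j (f \+ g) = j f + j g},
      forall (a : R), {in simple_functions, forall f, j (a \*: f) = a *: j f},
      forall m (B : 'I_m -> set E) (x : 'I_m -> X), disjoint_finite B ->
        (`|j (step B x)|)%:E = bochner_norm P p (compensated_step B x)
    & forall (v : V) (eps : R), 0 < eps ->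
        exists2 f, f \in simple_functions & `|v - j f| < eps].

(** * Cylindrical functions and the Malliavin derivative *)

Section cylindrical.
Variables (n M : nat) (B : 'I_M -> set E).
Variables (f : 'I_n -> ('I_M -> nat) -> R) (x : 'I_n -> X).

Definition counts (w : Omega) : 'I_M -> nat := fun k => count (B k) w.

Definition cylindrical (w : Omega) : X :=
  \sum_(i < n) f i (counts w) *: x i.

Definition malliavin (w : Omega) (e : E) : X :=
  \sum_(i < n) \sum_(m < M)
    (f i (fun k => (counts w k + (k == m))%N) - f i (counts w)) *:
      (\1_(B m) e *: x i).

End cylindrical.

(** The graph of the operator D from L^p(Omega; X) to L^p(Omega; V), where [V]
    is nu_p(E; X): the domain consists of the cylindrical [F] in L^p for which
    D F is in L^p. *)
Definition malliavin_graph (p : R) (V : normedModType R) (j : (E -> X) -> V)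
    (F : Omega -> X) (G : Omega -> V) :=
  [/\ bochner_Lp P p F, bochner_Lp P p G &
      exists n M (B : 'I_M.+1 -> set E)
        (f : 'I_n -> ('I_M.+1 -> nat) -> R) (x : 'I_n -> X),
      [/\ disjoint_finite B,
          {ae P, forall w, F w = cylindrical B f x w}
        & {ae P, forall w, G w = j (malliavin B f x w)}]].

End poisson.

(* Main.v *)
Require Import Defs.
From mathcomp Require Import all_boot all_order all_algebra.
From mathcomp Require Import all_classical all_reals all_analysis.
From mathcomp Require Import measurable_realfun ring lra.

(** Let F_n be cylindrical with F_n --> 0 in L^p and D F_n --> g.  Instead of an
    adjoint of D, the proof uses two facts about the Poisson process.

    The first one is Mecke's formula.  If k = (k_i) are the counts of the points
    of the process in disjoint sets D_i, with means lambda_i, then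
      E[k_i phi(k)] = lambda_i E[phi(k + e_i)]        for all phi >= 0.
    It turns the configuration with an added point, which enters in
    D F = sum_i (F(k + e_i) - F(k)) 1_{D_i}, back into the given one, at the
    cost of a factor k_i.  So on a fixed set A of finite measure, and on the
    event that A has at most a points, the p-th moment of the values of
    1_A D F_m is at most a constant, depending on a, p and the measure of A,
    times E|F_m|^p, and tends to 0 with m ([difference_truncated_bound]).  The
    same holds for the compensated integral of 1_A D F_m, when the configuration
    in this integral has at most b points in A
    ([compensated_sum_truncated_bound]).

    The second one is that f |-> 1_A f is a contraction of the Poisson p-norm:
    the remaining part of the compensated integral is independent and centered,
    so that removing it cannot increase a p-th moment
    ([compensated_sum_contraction]).  This is Jensen's inequality, and it is
    obtained from a supporting line of t |-> |y + t x|^p and Mecke's formula.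

    Now fix n and let A be the union of the sets in the representation of F_n.
    As D F_n vanishes off A,
      D F_n = 1_A (D F_n - D F_m) + 1_A D F_m,
    where the first term is bounded by the norm of D F_n - D F_m and the second
    one tends to 0 on the truncation events ([difference_le_of_approx]).
    Letting m tend to infinity, and removing the truncations afterwards, the
    norm of D F_n is at most a constant times limsup_m |D F_n - D F_m|, hence times
    |D F_n - g| ([integral_normX_le_of_approx]).  The latter tends to 0, thus
    D F_n --> 0 and g = 0.

    To compare F_n with F_m both are written over a common refinement of their
    sets ([common_refinement]).  All moments are then integrals of functions of
    one random vector of counts; the norm of nu_p(E; X) being itself a p-th
    moment, they are double integrals, where the outer variable is the argument
    of D F and the inner one that of the compensated integral. *)

Set Implicit Arguments.
Unset Strict Implicit.
Unset Printing Implicit Defensive.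

Import Order.TTheory GRing.Theory Num.Theory.
Import numFieldNormedType.Exports.

Local Open Scope classical_set_scope.
Local Open Scope ring_scope.

(** * Convexity of the powers of a norm *)

Lemma powR_norm_midpoint (R : realType) (X : normedModType R) (p : R) (y x : X)
    (a b : R) : 1 <= p -> 0 < a -> 0 < b ->
  (a + b) * `|y| `^ p <= b * `|y - a *: x| `^ p + a * `|y + b *: x| `^ p.
Proof.
move=> p1 a0 b0; have ab0 : 0 < a + b by rewrite addr_gt0.
have p0 : 0 <= p by rewrite (le_trans ler01).
pose t := b / (a + b).
have t01 : (0 <= t <= 1).
  by rewrite /t divr_ge0 ?(ltW ab0) ?(ltW b0)//= ler_pdivrMr// mul1r lerDr ltW.
have tE : 1 - t = a / (a + b) by rewrite /t; field; rewrite gt_eqF.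
have yE : y = t *: (y - a *: x) + (1 - t) *: (y + b *: x).
  have e : - (t * a) + (1 - t) * b = 0 by rewrite /t; field; rewrite gt_eqF.
  rewrite scalerBr scalerDr addrACA -scalerDl subrKC scale1r !scalerA.
  by rewrite -scaleNr -scalerDl e scale0r addr0.
have /andP[t0 t1] := t01.
have cvx : `|y| `^ p <= t * `|y - a *: x| `^ p + (1 - t) * `|y + b *: x| `^ p.
  have := convex_powR p1 (Itv01 t0 t1)
    (x := `|y - a *: x|) (y := `|y + b *: x|).
  rewrite !inE/= !in_itv/= !andbT !normr_ge0 => /(_ isT isT).
  apply: le_trans; rewrite ge0_ler_powR ?nnegrE//.
    by rewrite addr_ge0// mulr_ge0//= subr_ge0.
  rewrite [in leLHS]yE; apply: (le_trans (ler_normD _ _)).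
  rewrite (normrZ t) (normrZ (1 - t)).
  by rewrite (ger0_norm t0) ger0_norm ?subr_ge0.
rewrite mulrC -ler_pdivlMr//; apply: (le_trans cvx); rewrite tE /t le_eqVlt.
by apply/orP; left; apply/eqP; field; rewrite gt_eqF.
Qed.

(** The function t |-> |y + t x|^p is convex on the line.  The slope of a
    supporting line at 0 is the supremum of its difference quotients on the
    left, which lie below those on the right. *)
Lemma powR_norm_supporting_line (R : realType) (X : normedModType R) (p : R)
    (y x : X) : 1 <= p ->
  exists c : R, forall t : R, `|y| `^ p + c * t <= `|y + t *: x| `^ p.
Proof.
move=> p1; pose h (t : R) := `|y + t *: x| `^ p.
have h0 : h 0 = `|y| `^ p by rewrite /h scale0r addr0.
have sl a b : 0 < a -> 0 < b -> (h 0 - h (- a)) / a <= (h b - h 0) / b.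
  move=> a0 b0; have := powR_norm_midpoint y x p1 a0 b0.
  rewrite -h0 -/(h b) -scaleNr -/(h (- a)) => H.
  by rewrite ler_pdivrMr// mulrAC ler_pdivlMr//; lra.
pose S := [set (h 0 - h (- a)) / a | a in [set a : R | 0 < a]].
have S0 : S !=set0 by exists ((h 0 - h (- 1)) / 1); exists 1 => //=.
have Sub b : 0 < b -> ubound S ((h b - h 0) / b).
  by move=> b0 _ [a a0 <-]; exact: sl.
have hS : has_sup S by split => //; exists ((h 1 - h 0) / 1); exact: Sub.
exists (sup S) => t; rewrite -h0 -/(h t).
have [t0|t0|->] := ltgtP t 0; last by rewrite mulr0 addr0.
- have : (h 0 - h (- - t)) / (- t) <= sup S.
    by apply: sup_upper_bound => //; exists (- t) => //=; rewrite oppr_gt0.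
  by rewrite opprK ler_pdivrMr ?oppr_gt0//; lra.
- have : sup S <= (h t - h 0) / t by apply: ge_sup => //; exact: Sub.
  by rewrite ler_pdivlMr//; lra.
Qed.

Lemma powRD_le (R : realType) (p a b : R) : 0 <= p -> 0 <= a -> 0 <= b ->
  (a + b) `^ p <= 2 `^ p * (a `^ p + b `^ p).
Proof.
move=> p0 a0 b0.
have H u v : 0 <= u -> u <= v -> (u + v) `^ p <= 2 `^ p * (u `^ p + v `^ p).
  move=> u0 uv; have v0 := le_trans u0 uv.
  apply: (@le_trans _ _ ((2 * v) `^ p)).
    by rewrite ge0_ler_powR ?nnegrE//; lra.
  by rewrite powRM// ler_wpM2l ?powR_ge0// lerDr powR_ge0.
have [ab|/ltW ba] := leP a b; first exact: H.
by rewrite addrC [X in _ * X]addrC; exact: H.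
Qed.

Lemma powR_normD_le (R : realType) (X : normedModType R) (p : R) (x y : X) :
  0 <= p -> `|x + y| `^ p <= 2 `^ p * (`|x| `^ p + `|y| `^ p).
Proof.
move=> p0; apply: le_trans (powRD_le p0 _ _) => //.
by rewrite ge0_ler_powR ?nnegrE ?addr_ge0// ler_normD.
Qed.

(** Jensen's inequality for the weights w_i / W.  Their total mass may be less
    than 1: the missing mass is put at the point 0, where the power vanishes.
    The proof averages a supporting line at the mean. *)
Lemma powR_sum_le (R : realType) (I : finType) (Q : pred I) (p W : R)
    (w a : I -> R) :
  1 <= p -> 0 < W -> (forall i, 0 <= w i) -> (forall i, 0 <= a i) ->
  \sum_(i | Q i) w i <= W ->
  (\sum_(i | Q i) w i * a i) `^ p <=
    W `^ (p - 1) * \sum_(i | Q i) w i * a i `^ p.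
Proof.
move=> p1 W0 w0 a0 sW.
set A := \sum_(i | Q i) w i * a i.
have A0 : 0 <= A by apply: sumr_ge0 => i _; rewrite mulr_ge0.
pose s := A / W; have s0 : 0 <= s by rewrite divr_ge0// ltW.
have p0 : 0 <= p by rewrite (le_trans ler01).
have [c Hc] := powR_norm_supporting_line (s : R^o) (1 : R^o) p1.
have {}Hc b : 0 <= b -> s `^ p + c * (b - s) <= b `^ p.
  move=> b0; have := Hc (b - s).
  by rewrite /GRing.scale/= mulr1 subrKC !ger0_norm.
suff H : W * s `^ p <= \sum_(i | Q i) w i * a i `^ p.
  have AE : A = s * W by rewrite /s mulfVK// gt_eqF.
  rewrite AE powRM ?(ltW W0)// mulrC.
  have -> : W `^ p = W `^ (p - 1) * W.
    by rewrite -{3}(powRr1 (ltW W0)) -powRD ?subrK// (gt_eqF W0) implybT.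
  by rewrite -mulrA ler_wpM2l ?powR_ge0.
set u := \sum_(i | Q i) w i.
have h1 : u * s `^ p + c * (A - u * s) <= \sum_(i | Q i) w i * a i `^ p.
  rewrite /A /u mulr_suml mulr_suml -sumrB mulr_sumr -big_split/=.
  apply: ler_sum => i _.
  have -> : w i * s `^ p + c * (w i * a i - w i * s) =
    w i * (s `^ p + c * (a i - s)) by ring.
  by rewrite ler_wpM2l// Hc.
(* the part of the average that belongs to the missing mass, at 0 *)
have h2 : (W - u) * (s `^ p + c * (0 - s)) <= 0.
  rewrite mulr_ge0_le0 ?subr_ge0//.
  by have := Hc 0 (lexx 0); rewrite powR0//; lra.
have h3 : A = W * s by rewrite /s mulrC mulfVK// gt_eqF.
nra.
Qed.

(** * Integrals of almost everywhere measurable functions *)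

Section lower_integral.
Local Open Scope ereal_scope.
Context d (T : measurableType d) (R : realType).
Variable mu : {measure set T -> \bar R}.
Import HBNNSimple.
Implicit Types f h : T -> \bar R.

(** The integral of a nonnegative function is a supremum over the simple
    functions below it, so that only the upper bound has to be measurable.  The
    norm of a strongly measurable function is in general only almost everywhere
    equal to a measurable function, as the measure need not be complete. *)
Lemma ae_le_integral_measurable_ub f h :
  (forall x, 0 <= f x) -> (forall x, 0 <= h x) -> measurable_fun setT h ->
  {ae mu, forall x, f x <= h x} -> \int[mu]_x f x <= \int[mu]_x h x.
Proof.
move=> f0 h0 mh fh; rewrite (ge0_integralTE mu f0).
apply: ge_ereal_sup => _ /= [s sf <-].
rewrite -integralT_nnsfun. apply: ae_ge0_le_integral => //.
- by move=> x _; rewrite lee_fin.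
- exact/measurable_EFinP.
- by apply: filterS fh => x fhx _; exact: le_trans (sf x) fhx.
Qed.

Lemma ae_le_integral_measurable_lb h f :
  (forall x, 0 <= h x) -> (forall x, 0 <= f x) -> measurable_fun setT h ->
  {ae mu, forall x, h x <= f x} -> \int[mu]_x h x <= \int[mu]_x f x.
Proof.
move=> h0 f0 mh [Z [mZ Z0 hfZ]].
(* [h] cut off on the exceptional set is below [f] everywhere *)
pose h' := h \_ (~` Z).
have mh' : measurable_fun setT h'.
  apply/(measurable_restrictT h (measurableC mZ)).
  exact: measurable_funS mh.
have h'0 x : 0 <= h' x by rewrite /h' patchE; case: ifP.
have h'f x : h' x <= f x.
  rewrite /h' patchE; case: ifPn => // /set_mem Zx.
  by apply: contrapT => hx; apply: Zx; exact: hfZ.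
have -> : \int[mu]_x h x = \int[mu]_x h' x.
  apply: ge0_ae_eq_integral => //; exists Z; split => // x /= /not_implyP[_ hx].
  by apply: contrapT => Zx; apply: hx; rewrite /h' patchE ifT// inE.
rewrite (ge0_integralTE mu h'0) (ge0_integralTE mu f0).
apply: ereal_sup_le => _ /= [s sh <-].
by exists s => // x; exact: le_trans (sh x) (h'f x).
Qed.

Lemma ae_eq_integral_measurable f h :
  (forall x, 0 <= f x) -> (forall x, 0 <= h x) -> measurable_fun setT h ->
  {ae mu, forall x, f x = h x} -> \int[mu]_x f x = \int[mu]_x h x.
Proof.
move=> f0 h0 mh fh; apply/eqP; rewrite eq_le; apply/andP; split.
  by apply: ae_le_integral_measurable_ub => //; apply: filterS fh => x ->.
by apply: ae_le_integral_measurable_lb => //; apply: filterS fh => x ->.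
Qed.

Lemma integral_le_nondecreasing (g : nat -> T -> \bar R) f (C : \bar R) :
  (forall n, measurable_fun setT (g n)) -> (forall n x, 0 <= g n x) ->
  (forall x, nondecreasing_seq (g ^~ x)) ->
  (forall x, g n x @[n --> \oo] --> f x) ->
  (forall n, \int[mu]_x g n x <= C) -> \int[mu]_x f x <= C.
Proof.
move=> mg g0 ndg gf gC.
have -> : \int[mu]_x f x = \int[mu]_x limn (g ^~ x).
  by apply: eq_integral => x _; apply/esym/cvg_lim => //; exact: gf.
have := @cvg_monotone_convergence _ _ _ mu _ measurableT g mg
  (fun n x _ => g0 n x) (fun x _ => ndg x).
move=> /cvg_lim <-//; apply: lime_le; last exact: nearW.
apply: ereal_nondecreasing_is_cvgn => m n mn.
by apply: ge0_le_integral => // x _; exact: ndg.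
Qed.

Lemma cvg_truncation (n : nat) (y : \bar R) :
  ((n <= L)%N%:R%:E * y) @[L --> \oo] --> y.
Proof.
apply: cvg_near_cst; exists n => // L /= nL.
by rewrite nL mul1e.
Qed.

Lemma nondecreasing_truncation (n : nat) (y : \bar R) : 0 <= y ->
  nondecreasing_seq (fun L => (n <= L)%N%:R%:E * y).
Proof.
move=> y0 L L' LL'; rewrite lee_wpmul2r// lee_fin ler_nat.
by case: (leqP n L) => // nL; rewrite (leq_trans nL).
Qed.

Lemma integral_le_truncation (s : T -> nat) f (C : \bar R) :
  (forall L, measurable_fun setT (fun x => (s x <= L)%N%:R%:E * f x)) ->
  (forall x, 0 <= f x) ->
  (forall L, \int[mu]_x ((s x <= L)%N%:R%:E * f x) <= C) ->
  \int[mu]_x f x <= C.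
Proof.
move=> mf f0; apply: integral_le_nondecreasing => //.
- by move=> L x; rewrite mule_ge0.
- by move=> x; exact: nondecreasing_truncation.
- by move=> x; exact: cvg_truncation.
Qed.

End lower_integral.

(** * Strongly measurable functions *)

Section strong_measurability.
Local Open Scope ereal_scope.
Context d (Omega : measurableType d) (R : realType).
Variables (P : probability Omega R) (V : normedModType R).

Lemma measurable_fun_fimfun2 (W : normedModType R) (s t : {fimfun Omega >-> V})
    (h : V -> V -> W) (U : set W) :
  (forall v, measurable (s @^-1` [set v])) ->
  (forall v, measurable (t @^-1` [set v])) ->
  measurable ((fun w => h (s w) (t w)) @^-1` U).
Proof.
move=> ms mt.
have -> : (fun w => h (s w) (t w)) @^-1` U =
    \bigcup_(a in range s) \bigcup_(b in range t `&` [set b | U (h a b)])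
       (s @^-1` [set a] `&` t @^-1` [set b]).
  apply/seteqP; split => w /=.
    move=> Uw; exists (s w); first by exists w.
    by exists (t w) => //; split => //; exists w.
  by move=> [a _] [b [_ /= Uab]] [-> ->].
apply: fin_bigcup_measurable => [|a _]; first exact: fimfunP.
apply: fin_bigcup_measurable => [|b _]; last exact: measurableI.
by apply: finite_setIl; exact: fimfunP.
Qed.

(** The measurable function is the absolute value of the upper limit of the
    norms of the differences of the approximating simple functions, which makes
    sense also where the approximation fails. *)
Lemma strongly_measurable_normB (u v : Omega -> V) :
  strongly_measurable P u -> strongly_measurable P v ->
  exists phi : Omega -> \bar R, [/\ measurable_fun setT phi,
    forall w, 0 <= phi w & {ae P, forall w, (`|u w - v w|)%:E = phi w}].
Proof.
move=> [s [ms su]] [t [mt tv]].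
pose phin n w : \bar R := (`|s n w - t n w|)%:E.
exists (fun w => `|limn_esup (phin ^~ w)|); split => [||].
- apply: measurableT_comp => //.
  apply: measurable_fun_limn_esup => n; apply/measurable_EFinP => _ U mU.
  rewrite setTI.
  exact: (@measurable_fun_fimfun2 R^o (s n) (t n) (fun a b => `|a - b|%R)).
- by move=> w; exact: abse_ge0.
- apply: filterS2 su tv => w sw tw.
  have phi_cvg : phin n w @[n --> \oo] --> (`|u w - v w|)%:E.
    apply: cvg_EFin; first exact: nearW.
    by apply: cvg_norm; apply: cvgB.
  rewrite is_cvg_limn_esupE; last by apply/cvg_ex; exists (`|u w - v w|)%:E.
  by rewrite (cvg_lim _ phi_cvg)// abse_EFin normr_id.
Qed.

End strong_measurability.

Section bochner_norm_integral.
Local Open Scope ereal_scope.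
Context d (Omega : measurableType d) (R : realType).
Variables (P : probability Omega R) (V : normedModType R).

Lemma bochner_normX (p : R) (u : Omega -> V) : (0 < p)%R ->
  bochner_norm P p u `^ p = \int[P]_w (`|u w| `^ p)%:E.
Proof.
move=> p0; have pn0 : p != 0%R by rewrite gt_eqF.
rewrite /bochner_norm (poweR_Lnorm P _ pn0).
by apply: eq_integral => w _; rewrite abse_EFin normr_id poweR_EFin.
Qed.

Lemma cvg0_bochner_normX (p : R) (u : nat -> Omega -> V) (eps : R) :
  (0 < p)%R -> (0 < eps)%R -> bochner_norm P p (u n) @[n --> \oo] --> 0 ->
  \forall n \near \oo, \int[P]_w (`|u n w| `^ p)%:E <= eps%:E.
Proof.
move=> p0 eps0 /fine_cvgP[ufin /cvgr0_norm_lt une].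
have {}une := une _ (powR_gt0 p^-1 eps0).
near=> n.
have un : bochner_norm P p (u n) \is a fin_num by near: n.
have : (`|fine (bochner_norm P p (u n))| < eps `^ p^-1)%R by near: n.
rewrite -bochner_normX// -[in _ <= _](fineK un) poweR_EFin lee_fin.
rewrite ger0_norm; last exact/fine_ge0/Lnorm_ge0.
move=> /ltW uneps.
have -> : (eps = (eps `^ p^-1) `^ p)%R.
  by rewrite -powRrM mulVf ?gt_eqF// powRr1// ltW.
by rewrite ge0_ler_powR ?nnegrE ?powR_ge0 ?(ltW p0)//; exact/fine_ge0/Lnorm_ge0.
Unshelve. all: by end_near. Qed.

End bochner_norm_integral.

Section strongly_measurable_moments.
Local Open Scope ereal_scope.
Context d (Omega : measurableType d) (R : realType) (P : probability Omega R).
Variables (V : normedModType R) (p : R).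
Hypothesis p0 : (0 < p)%R.
Implicit Types u v z : Omega -> V.

Lemma strongly_measurable_normBX u v :
  strongly_measurable P u -> strongly_measurable P v ->
  exists psi : Omega -> \bar R, [/\ measurable_fun setT psi,
    forall w, 0 <= psi w &
    {ae P, forall w, (`|(u w - v w)%R| `^ p)%:E = psi w}].
Proof.
move=> su sv; have [phi [mphi phi0 phiE]] := strongly_measurable_normB su sv.
exists (fun w => phi w `^ p); split.
- exact: (measurableT_comp (measurable_poweR p)).
- by move=> w; exact: poweR_ge0.
- by apply: filterS phiE => w <-; rewrite poweR_EFin.
Qed.

Lemma integral_normBX_triangle u v z :
  strongly_measurable P u -> strongly_measurable P v ->
  strongly_measurable P z ->
  \int[P]_w (`|(u w - v w)%R| `^ p)%:E <=
  (2 `^ p)%:E * (\int[P]_w (`|(u w - z w)%R| `^ p)%:E +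
                 \int[P]_w (`|(v w - z w)%R| `^ p)%:E).
Proof.
move=> su sv sz.
have [a [ma a0 aE]] := strongly_measurable_normBX su sz.
have [b [mb b0 bE]] := strongly_measurable_normBX sv sz.
have X0 (y : Omega -> V) w : 0 <= (`|y w| `^ p)%:E by rewrite lee_fin powR_ge0.
rewrite (ae_eq_integral_measurable (X0 (fun w => u w - z w)%R) a0 ma aE).
rewrite (ae_eq_integral_measurable (X0 (fun w => v w - z w)%R) b0 mb bE).
rewrite -ge0_integralD// -ge0_integralZl ?lee_fin ?powR_ge0//; last 2 first.
- exact: emeasurable_funD.
- by move=> w _; rewrite adde_ge0.
apply: ae_le_integral_measurable_ub.
- by move=> w; rewrite lee_fin powR_ge0.
- by move=> w; rewrite mule_ge0 ?adde_ge0// lee_fin powR_ge0.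
- by apply: emeasurable_funM => //; exact: emeasurable_funD.
- apply: filterS2 aE bE => w <- <-; rewrite -EFinD -EFinM lee_fin.
  have := powR_normD_le (u w - z w)%R (z w - v w)%R (ltW p0).
  by rewrite addrA subrK (distrC (z w)).
Qed.

Lemma strongly_measurable_cst (v : V) : strongly_measurable P (fun=> v).
Proof.
exists (fun=> cst v); split => [_ y|]; last by apply: aeW => w; exact: cvg_cst.
by rewrite preimage_cst; case: ifP.
Qed.

Lemma ae_eq0_of_integral_normX u : strongly_measurable P u ->
  (forall eps : R, (0 < eps)%R -> \int[P]_w (`|u w| `^ p)%:E <= eps%:E) ->
  {ae P, forall w, u w = 0%R}.
Proof.
move=> su small.
have [a [ma a0 aE]] :=
  strongly_measurable_normBX su (strongly_measurable_cst 0%R).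
have X0 w : 0 <= (`|(u w - 0)%R| `^ p)%:E by rewrite lee_fin powR_ge0.
have ia : \int[P]_w `|a w| = 0.
  under eq_integral do rewrite gee0_abs//.
  rewrite -(ae_eq_integral_measurable X0 a0 ma aE).
  apply/eqP; rewrite eq_le integral_ge0 ?andbT//.
  apply/lee_addgt0Pr => eps eps0; rewrite add0e.
  by under eq_integral do rewrite subr0; exact: small.
have := ae_eq_integral_abs P measurableT ma; move=> [/(_ ia) aeq _].
apply: filterS2 aE aeq => w aw /(_ Logic.I) /=.
rewrite -aw subr0 => -[/eqP]; rewrite powR_eq0 (gt_eqF p0) andbT normr_eq0.
by move=> /eqP.
Qed.

End strongly_measurable_moments.

(** * Poisson weights and Mecke's formula *)

Definition incr (I : finType) (k : {ffun I -> nat}) (i : I) : {ffun I -> nat} :=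
  [ffun j => (k j + (j == i))%N].

Definition poisson_weight (R : realType) (lam : R) (k : nat) : R :=
  lam ^+ k / k`!%:R * expR (- lam).

Lemma poisson_weight_ge0 (R : realType) (lam : R) k :
  0 <= lam -> 0 <= poisson_weight lam k.
Proof. by move=> l0; rewrite mulr_ge0 ?expR_ge0// divr_ge0// exprn_ge0. Qed.

Lemma poisson_weightS (R : realType) (lam : R) k :
  k.+1%:R * poisson_weight lam k.+1 = lam * poisson_weight lam k.
Proof.
rewrite /poisson_weight exprS factS natrM.
by field; rewrite ?pnatr_eq0 -?lt0n ?fact_gt0//= -natr1 addrC natr1 pnatr_eq0.
Qed.

Lemma poisson_weight_sum (R : realType) (lam : R) : 0 <= lam ->
  (\sum_(k <oo) (poisson_weight lam k)%:E = 1)%E.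
Proof.
move=> l0; rewrite /poisson_weight.
under eq_eseriesr do rewrite mulrC EFinM.
rewrite nneseriesZl/=; last by move=> n _; rewrite lee_fin divr_ge0// exprn_ge0.
have -> : (\sum_(i <oo) (lam ^+ i / i`!%:R)%:E = (expR lam)%:E)%E.
  rewrite /expR -EFin_lim; last exact: is_cvg_series_exp_coeff.
  by apply/congr_lim/funext => n /=; rewrite /series/= -sumEFin.
by rewrite -EFinM expRN mulVf ?gt_eqF ?expR_gt0.
Qed.

Lemma esum_support (R : realType) (T : choiceType) (A : set T)
    (a : T -> \bar R) :
  (forall x, ~ A x -> a x = 0%E) ->
  (\esum_(x in A) a x = \esum_(x in [set: T]) a x)%E.
Proof.
move=> aA; rewrite esum_mkcond; apply: eq_esum => x _.
by case: ifPn => // /negP Ax; rewrite aA// => /mem_set.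
Qed.

Section mecke.
Local Open Scope ereal_scope.
Context d (Omega : measurableType d) (R : realType) (P : probability Omega R).
Variables (I : finType).
Implicit Types (k : {ffun I -> nat}) (phi : {ffun I -> nat} -> \bar R).

Definition discrete_rv (kap : Omega -> {ffun I -> nat}) :=
  forall k, measurable (kap @^-1` [set k]).

Lemma discrete_rv_preimage kap (U : set {ffun I -> nat}) :
  discrete_rv kap -> measurable (kap @^-1` U).
Proof.
move=> mkap.
have -> : kap @^-1` U = \bigcup_n (if @pickle_inv {ffun I -> nat} n is Some k
    then if k \in U then kap @^-1` [set k] else set0 else set0).
  apply/seteqP; split => w /=.
    by move=> Uw; exists (pickle (kap w)) => //=; rewrite pickleK_inv mem_set.
  move=> [n _]; case: pickle_inv => // k; case: ifPn => // /set_mem Uk /=.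
  by move=> ->.
apply: bigcup_measurable => n _.
by case: pickle_inv => // k; case: ifPn.
Qed.

Lemma measurable_discrete_rv kap phi :
  discrete_rv kap -> measurable_fun setT (fun w => phi (kap w)).
Proof.
move=> mkap _ U mU; rewrite setTI.
exact: (@discrete_rv_preimage kap (phi @^-1` U)).
Qed.

(** The countably many values are enumerated by [pickle], in order to exchange
    the sum over them with the integral. *)
Lemma integral_discrete_rv kap phi :
  discrete_rv kap -> (forall k, 0 <= phi k) ->
  \int[P]_w phi (kap w) =
  \esum_(k in [set: {ffun I -> nat}]) (phi k * P (kap @^-1` [set k])).
Proof.
move=> mkap phi0.
pose g n w := if @pickle_inv {ffun I -> nat} n is Some k
  then phi k * (\1_(kap @^-1` [set k]) w)%:E else 0.
have g0 n w : 0 <= g n w.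
  by rewrite /g; case: pickle_inv => // k; rewrite mule_ge0// lee_fin.
have mg n : measurable_fun setT (g n).
  rewrite /g; case: pickle_inv => [k|]; last exact: measurable_cst.
  apply: emeasurable_funM; first exact: measurable_cst.
  by apply/measurable_EFinP; exact: measurable_indic.
have -> : \int[P]_w phi (kap w) = \int[P]_w \sum_(n <oo) g n w.
  apply: eq_integral => w _; rewrite nneseries_esumT//.
  rewrite -(@esum_support _ _ [set pickle (kap w)]) => [|n /= nw].
    by rewrite esum_set1// /g pickleK_inv indicE mem_set// mule1.
  rewrite /g; case kE : pickle_inv => [k|]//.
  rewrite indicE memNset ?mule0// => /= kapE; apply: nw.
  by rewrite kapE -[n](@pickle_invK {ffun I -> nat}) kE.
rewrite integral_nneseries// nneseries_esumT; last first.
  by move=> n; exact: integral_ge0.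
rewrite -(@esum_support _ _ (range (@pickle {ffun I -> nat}))) => [|n /= nr].
  rewrite esum_image; last by move=> x y _ _; exact: (pcan_inj pickleK).
  apply: eq_esum => k _; rewrite /g pickleK_inv.
  rewrite ge0_integralZl ?integral_indic ?setIT//.
  by apply/measurable_EFinP; exact: measurable_indic.
rewrite /g; case kE : pickle_inv => [k|]; last by rewrite integral0.
have := @pickle_invK {ffun I -> nat} n; rewrite kE /= => nE.
by exfalso; apply: nr; exists k.
Qed.

(** Mecke's formula for finitely many cells: if [lam i] is not zero, the law of
    the counts with one point added in cell [i] has a density with respect to
    the law of the counts, which is the count in [i] divided by [lam i].  It
    replaces independence in all the estimates of moments. *)
Definition mecke (kap : Omega -> {ffun I -> nat}) (lam : I -> R) :=
  [/\ discrete_rv kap, forall i, (0 <= lam i)%R &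
      forall i phi, (forall k, 0 <= phi k) ->
        \int[P]_w ((kap w i)%:R%:E * phi (kap w)) =
        (lam i)%:E * \int[P]_w phi (incr (kap w) i)].

Lemma incr_inj i : injective (fun k => incr k i).
Proof.
move=> k k' /ffunP E; apply/ffunP => l; have := E l.
by rewrite !ffunE => /addIn.
Qed.

(** Atom by atom this is (r + 1) P(r + 1) = lam P(r) for Poisson weights; the
    atoms that are not reached by adding a point have no point in [i]. *)
Lemma independent_poisson_mecke kap (lam : I -> R) :
  discrete_rv kap -> (forall i, (0 <= lam i)%R) ->
  (forall k, P (kap @^-1` [set k]) =
     (\prod_i poisson_weight (lam i) (k i))%:E) ->
  mecke kap lam.
Proof.
move=> mkap lam0 Pk; split => // i phi phi0.
have w0 k : (0 <= \prod_i poisson_weight (lam i) (k i))%R.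
  by apply: prodr_ge0 => l _; exact: poisson_weight_ge0.
have psi0 k : 0 <= (k i)%:R%:E * phi k by rewrite mule_ge0// lee_fin.
rewrite (integral_discrete_rv mkap psi0).
rewrite -ge0_integralZl//; last 2 first.
  exact: (@measurable_discrete_rv kap (fun k => phi (incr k i))).
  by rewrite lee_fin.
rewrite (@integral_discrete_rv kap (fun k => (lam i)%:E * phi (incr k i)))//;
  last by move=> k; rewrite mule_ge0// lee_fin.
rewrite -(@esum_support _ _ (range (fun k => incr k i))) => [|k kNr];
  last first.
  suff -> : k i = 0%N by rewrite !mul0e.
  apply: contrapT => /eqP; rewrite -lt0n => ki; apply: kNr => /=.
  exists [ffun l => (k l - (l == i))%N] => //; apply/ffunP => l; rewrite !ffunE.
  by case: eqVneq => [->|_]; rewrite ?subnK// subn0 addn0.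
rewrite esum_image; last by move=> x y _ _; exact: incr_inj.
apply: eq_esum => k _; rewrite !Pk.
rewrite (bigD1 i)//= [in RHS](bigD1 i)//= !ffunE eqxx addn1.
under eq_bigr => l /negbTE li do rewrite ffunE li addn0.
set r := (\prod_(l | l != i) _)%R.
rewrite (muleC _ (phi _)) [X in _ = X * _]muleC -!muleA; congr (_ * _).
by rewrite -!EFinM (mulrA _.+1%:R) (mulrA (lam i)) poisson_weightS.
Qed.

End mecke.

(** * Moments of compensated sums of counts *)

Section mecke_inequalities.
Local Open Scope ereal_scope.
Context d (Omega : measurableType d) (R : realType) (P : probability Omega R).
Context (I : finType) (kap : Omega -> {ffun I -> nat}) (lam : I -> R).
Hypothesis kapP : mecke P kap lam.
Variables (X : normedModType R) (p : R).
Hypothesis p1 : (1 <= p)%R.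
Implicit Types (k : {ffun I -> nat}) (S : pred I) (u : I -> X).

Let p0 : (0 <= p)%R. Proof. exact: le_trans ler01 p1. Qed.
Let kap_discrete : discrete_rv kap. Proof. by case: kapP. Qed.
Let lam0 i : (0 <= lam i)%R. Proof. by case: kapP => _ + _; apply. Qed.

Let mfun (phi : {ffun I -> nat} -> \bar R) :
  measurable_fun setT (fun w => phi (kap w)).
Proof. exact: measurable_discrete_rv. Qed.

Let meckeE i (phi : {ffun I -> nat} -> R) : (forall k, (0 <= phi k)%R) ->
  \int[P]_w ((kap w i)%:R * phi (kap w))%:E =
  (lam i)%:E * \int[P]_w (phi (incr (kap w) i))%:E.
Proof.
move=> phi0; case: kapP => _ _ /(_ i (EFin \o phi)) <- //.
Qed.

Let le_E (f g : {ffun I -> nat} -> R) :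
  (forall k, (0 <= f k)%R) -> (forall k, (f k <= g k)%R) ->
  \int[P]_w (f (kap w))%:E <= \int[P]_w (g (kap w))%:E.
Proof.
move=> f0 fg; apply: ge0_le_integral => //.
- by move=> w _; rewrite lee_fin.
- exact: (mfun (fun k => (f k)%:E)).
- exact: (mfun (fun k => (g k)%:E)).
- by move=> w _; rewrite lee_fin.
Qed.

Let E_D (f g : {ffun I -> nat} -> R) :
  (forall k, (0 <= f k)%R) -> (forall k, (0 <= g k)%R) ->
  \int[P]_w (f (kap w) + g (kap w))%:E =
  \int[P]_w (f (kap w))%:E + \int[P]_w (g (kap w))%:E.
Proof.
move=> f0 g0; under eq_integral do rewrite EFinD.
rewrite ge0_integralD//=.
- by move=> w _; rewrite lee_fin.
- exact: (mfun (fun k => (f k)%:E)).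
- by move=> w _; rewrite lee_fin.
- exact: (mfun (fun k => (g k)%:E)).
Qed.

Let E_Z (c : R) (f : {ffun I -> nat} -> R) :
  (0 <= c)%R -> (forall k, (0 <= f k)%R) ->
  \int[P]_w (c * f (kap w))%:E = c%:E * \int[P]_w (f (kap w))%:E.
Proof.
move=> c0 f0; under eq_integral do rewrite EFinM.
rewrite ge0_integralZl ?lee_fin//; first exact: (mfun (fun k => (f k)%:E)).
by move=> w _; rewrite lee_fin.
Qed.

Let E_sum S (f : I -> {ffun I -> nat} -> R) :
  (forall i k, (0 <= f i k)%R) ->
  \int[P]_w (\sum_(i | S i) f i (kap w))%R%:E =
  \sum_(i | S i) \int[P]_w (f i (kap w))%:E.
Proof.
move=> f0; under eq_integral do rewrite -sumEFin -big_filter.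
rewrite -[RHS]big_filter ge0_integral_sum//=.
- by move=> i; exact: (mfun (fun k => (f i k)%:E)).
- by move=> i w _; rewrite lee_fin.
Qed.

Definition compensated_sum S u k : X :=
  (\sum_(i | S i) ((k i)%:R - lam i) *: u i)%R.

(** The supporting line of t |-> |Y + t x|^p at 0 has a slope c(Y) which, like
    Y, does not see the coordinate [i].  By Mecke's formula it therefore
    contributes c(Y) (k_i - lam_i) with mean zero.  As c(Y) need not be
    integrable, the comparison is made first on the events where |c(Y)| is
    bounded by an integer. *)
Lemma le_integral_add_centered (Y : {ffun I -> nat} -> X) (i : I) (x : X) :
  (forall k, Y (incr k i) = Y k) ->
  \int[P]_w (`|Y (kap w)| `^ p)%:E <=
  \int[P]_w (`|Y (kap w) + ((kap w i)%:R - lam i)%R *: x| `^ p)%:E.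
Proof.
move=> Yi.
pose c y := sval (cid (powR_norm_supporting_line y x p1)).
have cP y t : (`|y| `^ p + c y * t <= `|(y + t *: x)%R| `^ p)%R.
  exact: (svalP (cid (powR_norm_supporting_line y x p1))).
pose chi (L : nat) k : R := (Num.truncn `|c (Y k)| <= L)%N%:R.
pose f k := (`|Y k| `^ p)%R.
pose h k := (`|Y k + ((k i)%:R - lam i) *: x| `^ p)%R.
have f0 k : (0 <= f k)%R by exact: powR_ge0.
have h0 k : (0 <= h k)%R by exact: powR_ge0.
have chi0 L k : (0 <= chi L k)%R by exact: ler0n.
apply: (@integral_le_truncation _ _ _ _ (fun w => Num.truncn `|c (Y (kap w))|)).
- move=> L; exact: (mfun (fun k => (chi L k)%:E * (f k)%:E)).
- by move=> w; rewrite lee_fin.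
move=> L; under eq_integral do rewrite -EFinM.
(* positive and negative parts of the truncated slope: the terms of negative
   sign are moved to the other side, and all integrands are nonnegative *)
pose a k : R := (chi L k * Num.max (c (Y k)) 0)%R.
pose b k : R := (chi L k * Num.max (- c (Y k)) 0)%R.
have a0 k : (0 <= a k)%R by rewrite mulr_ge0// le_max lexx orbT.
have b0 k : (0 <= b k)%R by rewrite mulr_ge0// le_max lexx orbT.
have cL k : (Num.truncn `|c (Y k)| <= L)%N -> (`|c (Y k)| <= L.+1%:R)%R.
  by move=> cL; rewrite (le_trans (ltW (truncnS_gt _)))// ler_nat.
have aL k : (a k <= L.+1%:R)%R.
  rewrite /a /chi; case: leqP => [/cL {}cL|]; last by rewrite mul0r.
  by rewrite mul1r ge_max ler0n andbT (le_trans (ler_norm _)).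
have bL k : (b k <= L.+1%:R)%R.
  rewrite /b /chi; case: leqP => [/cL {}cL|]; last by rewrite mul0r.
  by rewrite mul1r ge_max ler0n andbT (le_trans (ler_norm _))// normrN.
have aEi k : a (incr k i) = a k by rewrite /a /chi Yi.
have bEi k : b (incr k i) = b k by rewrite /b /chi Yi.
have Efin g : (forall k, (0 <= g k)%R) -> (forall k, (g k <= L.+1%:R)%R) ->
    \int[P]_w (g (kap w))%:E \is a fin_num.
  move=> g0 gL; rewrite ge0_fin_numE; last first.
    by apply: integral_ge0 => w _; rewrite lee_fin.
  apply: (@le_lt_trans _ _ (\int[P]_w (cst L.+1%:R%:E w))).
    apply: ge0_le_integral => //.
    - by move=> w _; rewrite lee_fin.
    - exact: (mfun (fun k => (g k)%:E)).
    - by move=> w _; rewrite lee_fin.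
  by rewrite integral_cst// [X in _ * X](probability_setT P) mule1 ltry.
have ptw k : (chi L k * f k + (k i)%:R * a k + lam i * b k <=
              h k + lam i * a k + (k i)%:R * b k)%R.
  have := cP (Y k) ((k i)%:R - lam i)%R; rewrite -/(f k) -/(h k) /a /b /chi.
  case: leqP => _; rewrite ?mul0r ?mul1r ?mulr0 ?addr0//.
  have [c0|/ltW c0] := leP 0%R (c (Y k)).
    by rewrite (@max_r _ _ (- c (Y k))%R) ?oppr_le0//; lra.
  by rewrite (@max_l _ _ (- c (Y k))%R) ?oppr_ge0//; lra.
have Ki : forall g : {ffun I -> nat} -> R, (forall k, (0 <= g k)%R) ->
    (forall k, g (incr k i) = g k) ->
    \int[P]_w ((kap w i)%:R * g (kap w))%:E =
    (lam i)%:E * \int[P]_w (g (kap w))%:E.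
  by move=> q q0 qi; rewrite meckeE//; under eq_integral do rewrite qi.
have kb0 k : (0 <= (k i)%:R * b k)%R by rewrite mulr_ge0.
have ka0 k : (0 <= (k i)%:R * a k)%R by rewrite mulr_ge0.
have lb0 k : (0 <= lam i * b k)%R by rewrite mulr_ge0.
have la0 k : (0 <= lam i * a k)%R by rewrite mulr_ge0.
have cf0 k : (0 <= chi L k * f k)%R by rewrite mulr_ge0.
have lhs0 k : (0 <= chi L k * f k + (k i)%:R * a k)%R by rewrite addr_ge0.
have rhs0 k : (0 <= h k + lam i * a k)%R by rewrite addr_ge0.
have := le_E (fun k => addr_ge0 (lhs0 k) (lb0 k)) ptw.
rewrite (E_D lhs0 lb0) (E_D cf0 ka0) (E_D rhs0 kb0) (E_D h0 la0).
rewrite !E_Z// !Ki//.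
by rewrite leeD2rE ?leeD2rE// fin_numM// Efin.
Qed.

(** The discarded terms are put back one at a time: each is a multiple of a
    centered count on which the sum obtained so far does not depend. *)
Lemma compensated_sum_contraction S u :
  \int[P]_w (`|compensated_sum S u (kap w)| `^ p)%:E <=
  \int[P]_w (`|compensated_sum predT u (kap w)| `^ p)%:E.
Proof.
have H (r : seq I) : uniq r -> (forall i, i \in r -> ~~ S i) ->
    \int[P]_w (`|compensated_sum S u (kap w)| `^ p)%:E <=
    \int[P]_w (`|compensated_sum S u (kap w) +
      \sum_(i <- r) ((kap w i)%:R - lam i) *: u i|%R `^ p)%:E.
  elim: r => [_ _|i r IH /= /andP[ir ur] rS].
    by under [leRHS]eq_integral do rewrite big_nil addr0.
  apply: (le_trans (IH ur _)) => [l lr|]; first by rewrite rS// inE lr orbT.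
  under [leRHS]eq_integral do rewrite big_cons addrCA addrC.
  apply: (le_integral_add_centered (Y := fun k => compensated_sum S u k +
    \sum_(i <- r) ((k i)%:R - lam i) *: u i)%R) => k.
  congr (_ + _)%R; [apply: eq_bigr => l Sl | apply: eq_big_seq => l lr];
    rewrite ffunE (_ : l == i = false) ?addn0//; apply/eqP => li.
    by move: Sl; rewrite li; apply/negP; rewrite rS// mem_head.
  by move: ir; rewrite -li lr.
apply: (le_trans (H (enum (predC S)) (enum_uniq _) _)).
  by move=> i; rewrite mem_enum.
rewrite le_eqVlt; apply/orP; left; apply/eqP.
apply: eq_integral => w _; congr ((`|_| `^ _)%:E).
rewrite [RHS](bigID S)/=; congr (_ + _)%R.
by rewrite big_enum_cond; apply: eq_bigl => i; rewrite andbT.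
Qed.

Definition total_count S k : nat := (\sum_(i | S i) k i)%N.

Lemma total_count_incr S k i :
  S i -> total_count S (incr k i) = (total_count S k).+1.
Proof.
move=> Si; rewrite /total_count.
under eq_bigr do rewrite ffunE.
rewrite big_split/= -addn1; congr addn.
rewrite (bigD1 i)//= eqxx big1 ?addn0// => l /andP[_ /negbTE ->//].
Qed.

Let E_1 : \int[P]_w (cst 1 w) = 1.
Proof. by rewrite integral_cst// mul1e; exact: (probability_setT P). Qed.

Let E_coord i : \int[P]_w ((kap w i)%:R)%:E = (lam i)%:E.
Proof.
have := @meckeE i (fun=> 1%R) (fun=> ler01).
by rewrite E_1 mule1 => <-; under [RHS]eq_integral do rewrite mulr1.
Qed.

(** On the event that the total count is at most [n], the coefficients
    k_i + lam_i that dominate |k_i - lam_i| have bounded sum, and Jensen's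
    inequality applies.  The bound sees the cells only through [Lam], and is
    thus stable under refinement. *)
Lemma compensated_sum_truncated_bound S u (n : nat) (Lam : R) :
  (\sum_(i | S i) lam i <= Lam)%R ->
  \int[P]_w ((total_count S (kap w) <= n)%N%:R *
             `|compensated_sum S u (kap w)| `^ p)%:E <=
  (2 * (n%:R + Lam + 1) `^ (p - 1) *
     \sum_(i | S i) lam i * `|u i| `^ p)%R%:E.
Proof.
move=> SLam.
have Lam0 : (0 <= Lam)%R by apply: le_trans SLam; exact: sumr_ge0.
set W := (n%:R + Lam + 1)%R.
have W0 : (0 < W)%R by rewrite /W ltr_wpDl ?addr_ge0.
have kl0 i k : (0 <= (k i)%:R + lam i)%R by rewrite addr_ge0.
have klu0 i k : (0 <= ((k i)%:R + lam i) * `|u i| `^ p)%R.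
  by rewrite mulr_ge0// powR_ge0.
apply: (@le_trans _ _ (\int[P]_w (W `^ (p - 1) *
    \sum_(i | S i) ((kap w i)%:R + lam i) * `|u i| `^ p)%R%:E)).
  apply: (@le_E (fun k => (total_count S k <= n)%N%:R *
      `|compensated_sum S u k| `^ p)%R
    (fun k => W `^ (p - 1) *
      \sum_(i | S i) ((k i)%:R + lam i) * `|u i| `^ p)%R) => k.
    by rewrite mulr_ge0// powR_ge0.
  case: leqP => [kn|_]; last by rewrite mul0r mulr_ge0 ?powR_ge0// sumr_ge0.
  rewrite mul1r; apply: (@le_trans _ _
    ((\sum_(i | S i) ((k i)%:R + lam i) * `|u i|) `^ p)%R).
    rewrite ge0_ler_powR ?nnegrE//.
      by rewrite sumr_ge0// => i _; rewrite mulr_ge0.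
    apply: (le_trans (ler_norm_sum _ _ _)); apply: ler_sum => i _.
    rewrite normrZ ler_wpM2r// (le_trans (ler_normB _ _))//.
    by rewrite ger0_norm// ger0_norm.
  apply: powR_sum_le => //.
  rewrite big_split/= -natr_sum /W -addrA lerD ?ler_nat//.
  by rewrite (le_trans SLam)// lerDl.
rewrite (@E_Z _ (fun k => \sum_(i | S i) ((k i)%:R + lam i) * `|u i| `^ p)%R)
  ?powR_ge0//; last by move=> k; rewrite sumr_ge0.
rewrite (@E_sum S (fun i k => ((k i)%:R + lam i) * `|u i| `^ p)%R)//.
rewrite le_eqVlt; apply/orP; left; apply/eqP.
transitivity ((W `^ (p - 1))%:E *
    \sum_(i | S i) ((2 * (lam i * `|u i| `^ p))%R%:E)); last first.
  by rewrite sumEFin -EFinM -mulr_sumr; congr (_%:E); ring.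
congr (_ * _); apply: eq_bigr => i _.
under eq_integral do rewrite mulrC.
rewrite (@E_Z _ (fun k => (k i)%:R + lam i)%R) ?powR_ge0//.
rewrite (@E_D (fun k => (k i)%:R)%R (fun=> lam i))// E_coord.
have -> : \int[P]_w (lam i)%:E = (lam i)%:E.
  rewrite (integral_cst P measurableT) -[RHS]mule1; congr (_ * _).
  exact: (probability_setT P).
by rewrite -EFinD -EFinM; congr (_%:E); ring.
Qed.

Definition difference (Psi : {ffun I -> nat} -> X) k (i : I) : X :=
  (Psi (incr k i) - Psi k)%R.

(** Mecke's formula turns the terms with an added point into the factor
    [total_count S], which the truncation bounds; the point that was added
    raises the bound from [n] to [n.+1]. *)
Lemma difference_truncated_bound S (Psi : {ffun I -> nat} -> X) (n : nat)
    (Lam : R) :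
  (\sum_(i | S i) lam i <= Lam)%R ->
  \int[P]_w ((total_count S (kap w) <= n)%N%:R *
     \sum_(i | S i) lam i * `|difference Psi (kap w) i| `^ p)%R%:E <=
  (2 `^ p * (n.+1%:R + Lam))%R%:E * \int[P]_w (`|Psi (kap w)| `^ p)%:E.
Proof.
move=> SLam.
have Lam0 : (0 <= Lam)%R by apply: le_trans SLam; exact: sumr_ge0.
pose f k := (`|Psi k| `^ p)%R.
have f0 k : (0 <= f k)%R by exact: powR_ge0.
pose g k := ((total_count S k <= n.+1)%N%:R * f k)%R.
have g0 k : (0 <= g k)%R by rewrite mulr_ge0.
have tf0 i k : (0 <= (k i)%:R * g k)%R by rewrite mulr_ge0.
have lg0 i k : (0 <= lam i * g (incr k i))%R by rewrite mulr_ge0.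
apply: (@le_trans _ _ (\int[P]_w (2 `^ p *
   (\sum_(i | S i) lam i * g (incr (kap w) i) + Lam * f (kap w)))%R%:E)).
  apply: (@le_E (fun k => (total_count S k <= n)%N%:R *
     \sum_(i | S i) lam i * `|difference Psi k i| `^ p)%R
    (fun k => 2 `^ p *
     (\sum_(i | S i) lam i * g (incr k i) + Lam * f k))%R) => k.
    by rewrite mulr_ge0// sumr_ge0// => i _; rewrite mulr_ge0// powR_ge0.
  case: leqP => [kn|_]; last first.
    by rewrite mul0r mulr_ge0 ?powR_ge0// addr_ge0 ?mulr_ge0// sumr_ge0.
  rewrite mul1r; apply: (@le_trans _ _
    (2 `^ p * (\sum_(i | S i) lam i * g (incr k i) +
               (\sum_(i | S i) lam i) * f k))%R); last first.
    by rewrite ler_wpM2l ?powR_ge0// lerD2l ler_wpM2r.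
  rewrite mulr_suml -big_split/= mulr_sumr; apply: ler_sum => i Si.
  rewrite /g total_count_incr// ltnS kn mul1r -mulrDr mulrCA ler_wpM2l//.
  by apply: (le_trans (powR_normD_le _ _ p0)); rewrite normrN.
rewrite (@E_Z _ (fun k => \sum_(i | S i) lam i * g (incr k i) + Lam * f k)%R)
  ?powR_ge0//; last first.
  by move=> k; rewrite addr_ge0 ?mulr_ge0// sumr_ge0.
rewrite (@E_D (fun k => \sum_(i | S i) lam i * g (incr k i))%R
  (fun k => Lam * f k)%R) => [|k|k]; [|by rewrite sumr_ge0|by rewrite mulr_ge0].
rewrite EFinM -muleA lee_wpmul2l ?lee_fin ?powR_ge0//.
rewrite EFinD ge0_muleDl ?lee_fin// E_Z// leeD2r//.
rewrite (@E_sum S (fun i k => lam i * g (incr k i))%R)//.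
have -> : \sum_(i | S i) \int[P]_w (lam i * g (incr (kap w) i))%:E =
    \sum_(i | S i) \int[P]_w ((kap w i)%:R * g (kap w))%:E.
  by apply: eq_bigr => i _; rewrite meckeE// (@E_Z _ (fun k => g (incr k i))).
rewrite -(@E_sum S (fun i k => (k i)%:R * g k)%R)// -(E_Z (ler0n _ _) f0).
apply: (@le_E (fun k => \sum_(i | S i) (k i)%:R * g k)%R
  (fun k => n.+1%:R * f k)%R) => k; first by rewrite sumr_ge0.
rewrite -mulr_suml -natr_sum -/(total_count S k) /g.
case: leqP => [kn|_]; last by rewrite mul0r mulr0 mulr_ge0.
by rewrite mul1r ler_wpM2r// ler_nat.
Qed.

Lemma compensated_sumB S u v k :
  compensated_sum S (fun i => (u i - v i)%R) k =
  (compensated_sum S u k - compensated_sum S v k)%R.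
Proof.
by rewrite /compensated_sum -sumrB; apply: eq_bigr => i _; rewrite scalerBr.
Qed.

(** The key estimate, applied with [Phi] standing for F_n and [Psi] for F_m:
    as the derivative of [Phi] lives on [S], it is the restriction to [S] of its
    difference with the derivative of [Psi], which the contraction property
    controls, plus the restriction of the derivative of [Psi], which is small
    with [Psi].  The constant depends on the cells only through [Lam]. *)
Lemma difference_le_of_approx S (Phi Psi : {ffun I -> nat} -> X) (n m : nat)
    (Lam : R) :
  (\sum_(i | S i) lam i <= Lam)%R ->
  (forall i, ~~ S i -> forall k, difference Phi k i = 0%R) ->
  \int[P]_w ((total_count S (kap w) <= n)%N%:R%:E *
    \int[P]_w' ((total_count S (kap w') <= m)%N%:R *
      `|compensated_sum predT (difference Phi (kap w)) (kap w')| `^ p)%:E) <=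
  (2 `^ p)%:E * (\int[P]_w \int[P]_w' (`|compensated_sum predT
      (fun i => difference Psi (kap w) i - difference Phi (kap w) i)%R
      (kap w')| `^ p)%:E +
    (2 * (m%:R + Lam + 1) `^ (p - 1) * (2 `^ p * (n.+1%:R + Lam)))%R%:E *
      \int[P]_w (`|Psi (kap w)| `^ p)%:E).
Proof.
move=> SLam PhiS.
have Lam0 : (0 <= Lam)%R by apply: le_trans SLam; exact: sumr_ge0.
set C := (2 * _ `^ _)%R.
have C0 : (0 <= C)%R by rewrite mulr_ge0// powR_ge0.
pose Q (u : I -> X) := \int[P]_w (`|compensated_sum predT u (kap w)| `^ p)%:E.
have Q0 u : 0 <= Q u by apply: integral_ge0 => w _; rewrite lee_fin powR_ge0.
pose s k := (\sum_(i | S i) lam i * `|difference Psi k i| `^ p)%R.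
have s0 k : (0 <= s k)%R.
  by apply: sumr_ge0 => i _; rewrite mulr_ge0// powR_ge0.
pose q k := Q (fun i => difference Psi k i - difference Phi k i)%R.
have inner k : \int[P]_w' ((total_count S (kap w') <= m)%N%:R *
      `|compensated_sum predT (difference Phi k) (kap w')| `^ p)%:E <=
    (2 `^ p)%:E * (q k + (C * s k)%:E).
  have -> : compensated_sum predT (difference Phi k) =
      compensated_sum S (difference Phi k).
    apply/funext => k'; rewrite /compensated_sum (bigID S)/=.
    rewrite [X in (_ + X)%R]big1 ?addr0//.
    by move=> i Si; rewrite PhiS// scaler0.
  set dPhi := difference Phi k; set dPsi := difference Psi k.
  pose a k' :=
    ((total_count S k' <= m)%N%:R * `|compensated_sum S dPsi k'| `^ p)%R.
  pose b k' :=
    (`|compensated_sum S (fun i => dPsi i - dPhi i)%R k'| `^ p)%R.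
  have a0 k' : (0 <= a k')%R by rewrite mulr_ge0// powR_ge0.
  have b0 k' : (0 <= b k')%R by exact: powR_ge0.
  apply: (@le_trans _ _ (\int[P]_w (2 `^ p * (b (kap w) + a (kap w)))%:E)).
    apply: (@le_E (fun k' => (total_count S k' <= m)%N%:R *
        `|compensated_sum S dPhi k'| `^ p)%R
      (fun k' => 2 `^ p * (b k' + a k'))%R) => k'.
      by rewrite mulr_ge0// powR_ge0.
    rewrite /a; case: leqP => _; last first.
      by rewrite !mul0r addr0 mulr_ge0// powR_ge0.
    rewrite !mul1r /b compensated_sumB.
    have := powR_normD_le
      (compensated_sum S dPsi k' - compensated_sum S dPhi k')%R
      (- compensated_sum S dPsi k')%R p0.
    by rewrite addrAC subrr sub0r !normrN.
  rewrite (@E_Z _ (fun k' => b k' + a k')%R) ?powR_ge0//; last first.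
    by move=> k'; rewrite addr_ge0.
  rewrite (E_D b0 a0); apply: lee_wpmul2l; first by rewrite lee_fin powR_ge0.
  apply: leeD; first exact: compensated_sum_contraction.
  exact: compensated_sum_truncated_bound.
pose t k : R := (total_count S k <= n)%N%:R.
have t0 k : (0 <= t k)%R by exact: ler0n.
have ts0 k : (0 <= t k * s k)%R by exact: mulr_ge0.
have Cts0 k : (0 <= C * (t k * s k))%R by exact: mulr_ge0.
apply: (@le_trans _ _ (\int[P]_w ((2 `^ p)%:E *
    (q (kap w) + C%:E * (t (kap w) * s (kap w))%:E)))).
  apply: ge0_le_integral => //.
  - move=> w _; rewrite mule_ge0//; apply: integral_ge0 => w' _.
    by rewrite lee_fin mulr_ge0// powR_ge0.
  - exact: (mfun (fun k => (t k)%:E * \int[P]_w'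
      ((total_count S (kap w') <= m)%N%:R *
      `|compensated_sum predT (difference Phi k) (kap w')| `^ p)%:E)).
  - exact: (mfun (fun k => (2 `^ p)%:E * (q k + C%:E * (t k * s k)%:E))).
  - move=> w _; rewrite /t; case: leqP => _; last first.
      rewrite mul0e mul0r mule0 adde0 mule_ge0 ?lee_fin ?powR_ge0//.
      exact: Q0.
    by rewrite mul1e mul1r -EFinM; exact: inner.
rewrite ge0_integralZl ?lee_fin ?powR_ge0//; last 2 first.
- exact: (mfun (fun k => q k + C%:E * (t k * s k)%:E)).
- move=> w _; rewrite adde_ge0//; first exact: Q0.
  by rewrite -EFinM lee_fin.
rewrite lee_wpmul2l ?lee_fin ?powR_ge0// ge0_integralD//; last 3 first.
- by move=> w _; exact: Q0.
- by move=> w _; rewrite -EFinM lee_fin.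
- exact: (mfun (fun k => C%:E * (t k * s k)%:E)).
rewrite leeD2l// ge0_integralZl ?lee_fin//; last 2 first.
- exact: (mfun (fun k => (t k * s k)%:E)).
- by move=> w _; rewrite lee_fin.
rewrite [X in _ <= X * _]EFinM -muleA; apply: lee_wpmul2l.
  by rewrite lee_fin.
exact: difference_truncated_bound.
Qed.

End mecke_inequalities.

(** * Counts of a Poisson random measure *)

Lemma ae_eq_measure d (T : measurableType d) (R : realType)
    (mu : {measure set T -> \bar R}) (A B : set T) :
  measurable A -> measurable B -> {ae mu, forall x, A x <-> B x} ->
  mu A = mu B.
Proof.
move=> mA mB AB.
rewrite -[in LHS](setIT A) -[in RHS](setIT B).
rewrite -(integral_indic mu measurableT mA) -(integral_indic mu measurableT mB).
apply: ge0_ae_eq_integral => //.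
- by apply/measurable_EFinP; exact: measurable_indic.
- by apply/measurable_EFinP; exact: measurable_indic.
- apply: filterS AB => x [xAB xBA] _; rewrite !indicE.
  suff -> : (x \in A) = (x \in B) by [].
  by apply/idP/idP; rewrite !inE.
Qed.

Section poisson_counts.
Local Open Scope ereal_scope.
Context d d' (Omega : measurableType d) (E : measurableType d') (R : realType).
Variables (P : probability Omega R) (mu : {measure set E -> \bar R}).
Variable N : R.-ker Omega ~> E.
Hypothesis hN : poisson_random_measure P mu N.

Let integer_valued w B : measurable B ->
  N w B = +oo \/ exists k : nat, N w B = k%:R%:E.
Proof. by case: hN => h _ _ _; exact: h. Qed.

Lemma measurable_kernel_level B (y : \bar R) :
  measurable B -> measurable [set w | N w B = y].
Proof.
move=> mB; have := measurable_kernel N B mB measurableT _ (emeasurable_set1 y).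
by rewrite setTI.
Qed.

(** The Poisson weights have total mass 1, which leaves none for the value
    +oo. *)
Lemma ae_finite_count B : measurable B -> mu B < +oo ->
  {ae P, forall w, N w B = (Defs.count N B w)%:R%:E}.
Proof.
move=> mB Bfin.
pose A k := [set w | N w B = k%:R%:E].
have mA k : measurable (A k) by exact: measurable_kernel_level.
have tA : trivIset setT A.
  move=> k l _ _ [w [/= Nk Nl]]; have [/eqP] := etrans (esym Nk) Nl.
  by rewrite eqr_nat => /eqP.
have PA : P (\bigcup_k A k) = 1.
  rewrite measure_semi_bigcup//; last exact: bigcup_measurable.
  rewrite -(@poisson_weight_sum R (fine (mu B))) ?fine_ge0//.
  by apply: eq_eseriesr => k _; case: hN => _ h _ _; exact: h.
exists (~` \bigcup_k A k); split.
- by apply: measurableC; exact: bigcup_measurable.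
- by rewrite probability_setC ?PA ?subee//; exact: bigcup_measurable.
- apply: subsetC => w [k _ /= Nk].
  by rewrite /Defs.count Nk/= natrK.
Qed.

(** The junk value 0 of [count] adds the event of an infinite measure to the
    level 0. *)
Lemma measurable_count_level B k :
  measurable B -> measurable [set w | Defs.count N B w = k].
Proof.
move=> mB.
have -> : [set w | Defs.count N B w = k] = [set w | N w B = k%:R%:E] `|`
    (if k == 0%N then [set w | N w B = +oo] else set0).
  apply/seteqP; split => w /=.
    rewrite /Defs.count; case: (integer_valued w mB) => [Nw|[l Nw]].
      by rewrite Nw /= truncn0 => <-; right; rewrite eqxx.
    by rewrite Nw /= natrK => <-; left.
  by case=> [|]; rewrite /Defs.count; [move=> ->/=; rewrite natrK |
    case: eqP => // -> /= -> /=; rewrite truncn0].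
apply: measurableU; first exact: measurable_kernel_level.
by case: ifP => // _; exact: measurable_kernel_level.
Qed.

Section family.
Context (I : finType) (D : I -> set E).

Definition family_counts w : {ffun I -> nat} :=
  [ffun i => Defs.count N (D i) w].

Definition rate (i : I) : R := fine (mu (D i)).

Hypotheses (Dm : forall i, measurable (D i)) (Df : forall i, mu (D i) < +oo).

Lemma ae_family_counts :
  {ae P, forall w, forall i, N w (D i) = (family_counts w i)%:R%:E}.
Proof.
apply: filter_forall => i; apply: filterS (ae_finite_count (Dm i) (Df i)).
by move=> w ->; rewrite ffunE.
Qed.

Lemma discrete_family_counts : discrete_rv family_counts.
Proof.
move=> k.
have -> : family_counts @^-1` [set k] =
    \bigcap_(i in [set: I]) [set w | Defs.count N (D i) w = k i].
  apply/seteqP; split => w /=; first by move=> <- i _ /=; rewrite ffunE.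
  by move=> h; apply/ffunP => i; rewrite ffunE; exact: h.
apply: fin_bigcap_measurable; first exact: finite_finset.
by move=> i _; exact: measurable_count_level.
Qed.

Hypothesis Dt : trivIset setT D.

Lemma family_counts_law k :
  P (family_counts @^-1` [set k]) =
  (\prod_i poisson_weight (rate i) (k i))%R%:E.
Proof.
case: hN => _ pois _ indep.
pose e := @enum_val I predT.
have tDe : trivIset setT (D \o e).
  rewrite trivIset_comp; first exact: sub_trivIset Dt.
  by move=> i l _ _; exact: enum_val_inj.
pose A i := [set ((k (e i))%:R%:E : \bar R)].
transitivity (P (\bigcap_i [set w | A i (N w ((D \o e) i))])).
  apply: ae_eq_measure.
  - exact: discrete_family_counts.
  - apply: fin_bigcap_measurable; first exact: finite_finset.
    by move=> i _; exact: (measurable_kernel_level _ (Dm _)).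
  - apply: filterS ae_family_counts => w Nw; split => [/= wk i _ /=|/= h].
      by rewrite /A /= Nw wk.
    apply/ffunP => i; have := h (enum_rank i) Logic.I.
    rewrite /A /= /e enum_rankK Nw => -[/eqP].
    by rewrite eqr_nat => /eqP.
rewrite (indep _ (D \o e) A (fun i => Dm _) tDe (fun i => emeasurable_set1 _)).
rewrite (big_enum_val (fun i => poisson_weight (rate i) (k i)))/= -prodEFin.
by apply: eq_bigr => i _; rewrite /A /= pois.
Qed.

Lemma family_counts_mecke : mecke P family_counts rate.
Proof.
apply: independent_poisson_mecke.
- exact: discrete_family_counts.
- by move=> i; exact: fine_ge0.
- exact: family_counts_law.
Qed.

End family.
End poisson_counts.

(** * Common refinements of disjoint families *)

Lemma big_fibers (T : Type) (idx : T) (op : Monoid.com_law idx) (I J : finType)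
    (al : I -> option J) (F : I -> T) :
  \big[op/idx]_(i | al i != None) F i =
  \big[op/idx]_m \big[op/idx]_(i | al i == Some m) F i.
Proof.
under [RHS]eq_bigr do rewrite big_mkcond.
rewrite exchange_big/= big_mkcond; apply: eq_bigr => i _.
rewrite -big_mkcond/=; case: (al i) => [m|]/=; last by rewrite big_pred0.
by rewrite (big_pred1 m)// => m'; rewrite eq_sym.
Qed.

(** A family [D] refines a disjoint family [B] through [al], which gives the
    member of [B] that contains a given member of [D], or [None] for the members
    of [D] that lie outside of the union of [B]. *)
Section refinement.
Context (I J : finType) (al : I -> option J).

(** The counts in the sets of [B], as a function of those in the sets of [D]. *)
Definition pull (k : {ffun I -> nat}) (m : J) : nat :=
  (\sum_(i | al i == Some m) k i)%N.

Lemma pull_incr k i m : al i = Some m ->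
  pull (incr k i) = (fun m' => (pull k m' + (m' == m))%N).
Proof.
move=> im; apply/funext => m'; rewrite /pull.
under eq_bigr do rewrite ffunE.
rewrite big_split/=; congr addn.
have [->|mm'] := eqVneq m' m.
  rewrite (bigD1 i) ?im//= eqxx big1 ?addn0// => l /andP[_ /negbTE ->//].
rewrite big1// => l /eqP lm'; case: eqVneq => // li.
by move: mm'; rewrite -(inj_eq Some_inj) -lm' -im li eqxx.
Qed.

Lemma pull_incr_None k i : al i = None -> pull (incr k i) = pull k.
Proof.
move=> iN; apply/funext => m; apply: eq_bigr => l /eqP lm; rewrite ffunE.
by case: eqVneq => [li|]; rewrite ?addn0//; move: lm; rewrite li iN.
Qed.

Context (E : Type) (D : I -> set E) (B : J -> set E).

Definition refinement :=
  forall m, B m = \bigcup_(i in [set i | al i == Some m]) D i.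

Hypotheses (DB : refinement) (Dt : trivIset setT D).

Lemma indic_refinement (R : pzRingType) m e :
  \1_(B m) e = \sum_(i | al i == Some m) \1_(D i) e :> R.
Proof.
rewrite indicE DB.
case: (asboolP ((\bigcup_(i in [set i | al i == Some m]) D i) e)).
  move=> Be; rewrite mem_set//=; case: Be => i /= im Die.
  rewrite (bigD1 i)//= indicE mem_set// big1 ?addr0// => l /andP[_ li].
  rewrite indicE memNset// => Dle; move/eqP: li; apply.
  by apply: Dt => //; exists e.
move=> Be; rewrite memNset// big1// => i im; rewrite indicE memNset// => Die.
by apply: Be; exists i.
Qed.

End refinement.

Lemma measure_refinement (I J : finType) (al : I -> option J) d
    (E : measurableType d) (R : realType) (mu : {measure set E -> \bar R})
    (D : I -> set E) (B : J -> set E) m :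
  refinement al D B -> trivIset setT D -> (forall i, measurable (D i)) ->
  mu (B m) = (\sum_(i | al i == Some m) mu (D i))%E.
Proof.
move=> DB Dt Dm; rewrite DB measure_fin_bigcup//.
- by rewrite [RHS]bigfs ?index_enum_uniq// => i _; rewrite mem_index_enum.
- exact: finite_finset.
- exact: sub_trivIset Dt.
Qed.

Section disjoint_family.
Context d (E : measurableType d) (R : realType).
Variable mu : {measure set E -> \bar R}.

Definition disjoint_family (I : finType) (D : I -> set E) :=
  [/\ forall i, measurable (D i), forall i, (mu (D i) < +oo)%E
    & trivIset setT D].

(** The partition generated by [B], [None] being the index of the complement of
    the union. *)
Let side (J : finType) (B : J -> set E) (a : option J) :=
  if a is Some m then B m else ~` \bigcup_m B m.

Let side_disjoint (J : finType) (B : J -> set E) a a' e :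
  trivIset setT B -> side B a e -> side B a' e -> a = a'.
Proof.
move=> Bt; case: a => [m|]; case: a' => [m'|]//=.
- by move=> Bm Bm'; congr Some; apply: Bt => //; exists e.
- by move=> Bm; case; exists m.
- by move=> h Bm; case: h; exists m'.
Qed.

Let side_measurable (J : finType) (B : J -> set E) a :
  (forall m, measurable (B m)) -> measurable (side B a).
Proof.
move=> mB; case: a => [m|]//=; apply: measurableC.
by apply: fin_bigcup_measurable => //; exact: finite_finset.
Qed.

Let side_total (J : finType) (B : J -> set E) e : exists a, side B a e.
Proof.
have [[m _ Bm]|] := pselect ((\bigcup_m B m) e); first by exists (Some m).
by exists None.
Qed.

(** The cells are the intersections of an atom of [B] with an atom of [C].  The
    one outside of both unions may have infinite measure and is replaced by the
    empty set. *)
Lemma common_refinement (J J' : finType) (B : J -> set E) (C : J' -> set E) :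
  disjoint_family B -> disjoint_family C ->
  exists (I : finType) (D : I -> set E) (al : I -> option J)
    (be : I -> option J'),
    [/\ disjoint_family D, refinement al D B & refinement be D C].
Proof.
move=> [Bm Bf Bt] [Cm Cf Ct].
pose D (i : option J * option J') : set E :=
  if (i.1 == None) && (i.2 == None) then set0 else side B i.1 `&` side C i.2.
have Dside i e : D i e -> side B i.1 e /\ side C i.2 e.
  by rewrite /D; case: ifP.
have mD i : measurable (D i).
  by rewrite /D; case: ifP => // _; apply: measurableI; exact: side_measurable.
exists (option J * option J')%type, D, fst, snd; split; first split => //.
- have Dle i A : measurable A -> (mu A < +oo)%E -> D i `<=` A ->
      (mu (D i) < +oo)%E.
    by move=> mA Af DA; apply: le_lt_trans Af; apply: le_measure; rewrite ?inE.
  move=> [[m|] b].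
    by apply: (Dle _ (B m)) => // e /Dside[].
  case: b => [m'|]; last by rewrite /D /= measure0.
  by apply: (Dle _ (C m')) => // e /Dside[].
- move=> [a b] [a' b'] _ _ [e [/Dside[/= Ba Cb] /Dside[/= Ba' Cb']]].
  by rewrite (side_disjoint Bt Ba Ba') (side_disjoint Ct Cb Cb').
- move=> m; apply/seteqP; split => [e Be|e [i /= /eqP im /Dside[+ _]]].
    have [b Cb] := side_total C e.
    by exists (Some m, b); [exact: eqxx | split].
  by rewrite im.
- move=> m; apply/seteqP; split => [e Ce|e [i /= /eqP im /Dside[_ +]]].
    have [a Ba] := side_total B e.
    by exists (a, Some m); [exact: eqxx | rewrite /D/= andbF; split].
  by rewrite im.
Qed.

End disjoint_family.

(** * Cylindrical functions over a refinement *)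

Section closability.
Local Open Scope ereal_scope.
Context d d' (Omega : measurableType d) (E : measurableType d') (R : realType).
Variables (P : probability Omega R) (mu : {measure set E -> \bar R}).
Variable N : R.-ker Omega ~> E.
Hypothesis hN : poisson_random_measure P mu N.
Variables (X : normedModType R) (p : R) (V : completeNormedModType R).
Variable j : (E -> X) -> V.
Hypotheses (p1 : (1 < p)%R) (hj : nu_completion P mu N p j).

Let p0 : (0 < p)%R. Proof. exact: lt_trans p1. Qed.

Local Notation kap := (family_counts N).

Definition step_family (I : finType) (D : I -> set E) (u : I -> X)
    (e : E) : X :=
  (\sum_i \1_(D i) e *: u i)%R.

Lemma step_family_enum (I : finType) (D : I -> set E) (u : I -> X) :
  step_family D u =
  step (fun i : 'I_#|I| => D (enum_val i)) (fun i => u (enum_val i)).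
Proof.
apply/funext => e; rewrite /step_family /step.
by rewrite (big_enum_val (fun i => \1_(D i) e *: u i)%R).
Qed.

Lemma disjoint_family_enum (I : finType) (D : I -> set E) :
  disjoint_family mu D ->
  disjoint_finite mu (fun i : 'I_#|I| => D (enum_val i)).
Proof.
move=> [Dm Df Dt]; split => // i l _ _ h; apply: enum_val_inj.
exact: Dt h.
Qed.

Lemma step_family_simple (I : finType) (D : I -> set E) (u : I -> X) :
  disjoint_family mu D -> step_family D u \in @simple_functions _ E R mu X.
Proof.
move=> dD; rewrite inE; eexists _, _, _; split; last exact: step_family_enum.
exact: disjoint_family_enum.
Qed.

Lemma norm_step_family (I : finType) (D : I -> set E) (u : I -> X) :
  disjoint_family mu D ->
  (`|j (step_family D u)| `^ p)%:E =
  \int[P]_w (`|compensated_sum (rate mu D) predT u (kap D w)| `^ p)%:E.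
Proof.
move=> dD; case: hj => _ _ jE _.
rewrite step_family_enum -poweR_EFin jE; last exact: disjoint_family_enum.
rewrite [LHS](bochner_normX P _ p0); case: dD => Dm Df Dt.
apply: ae_eq_integral_measurable.
- by move=> w; rewrite lee_fin powR_ge0.
- by move=> w; rewrite lee_fin powR_ge0.
- apply: (measurable_discrete_rv (fun k =>
    (`|compensated_sum (rate mu D) predT u k| `^ p)%:E)).
  exact: (discrete_family_counts hN).
- apply: filterS (ae_family_counts hN Dm Df) => w Nw.
  congr ((`|_| `^ _)%:E); rewrite /compensated_step /compensated_sum.
  rewrite [RHS](big_enum_val
    (fun i => ((kap D w i)%:R - rate mu D i) *: u i)%R).
  by apply: eq_bigr => i _; rewrite /compensated Nw.
Qed.

(** The map [j] is additive, and u = (u - v) + v. *)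
Lemma norm_step_familyB (I : finType) (D : I -> set E) (u v : I -> X) :
  disjoint_family mu D ->
  (`|(j (step_family D u) - j (step_family D v))%R| `^ p)%:E =
  \int[P]_w (`|compensated_sum (rate mu D) predT
                 (fun i => u i - v i)%R (kap D w)| `^ p)%:E.
Proof.
move=> dD; rewrite -norm_step_family//; congr ((`|_| `^ _)%:E).
apply/eqP; rewrite subr_eq; apply/eqP; case: hj => jD _ _ _.
rewrite -jD ?step_family_simple//; congr j; apply/funext => e /=.
rewrite /step_family -big_split/=; apply: eq_bigr => i _.
by rewrite -scalerDr subrK.
Qed.

Definition cylinder_fun (n : nat) (T : Type) (f : 'I_n -> T -> R)
    (x : 'I_n -> X) (c : T) : X := (\sum_(i < n) f i c *: x i)%R.

Section represented.
Variables (n M : nat) (B : 'I_M -> set E).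
Variables (f : 'I_n -> ('I_M -> nat) -> R) (x : 'I_n -> X).
Variables (I : finType) (D : I -> set E) (al : I -> option 'I_M).
Hypotheses (dD : disjoint_family mu D) (DB : refinement al D B).

Lemma ae_counts_refinement :
  {ae P, forall w, counts N B w = pull al (kap D w)}.
Proof.
case: dD => Dm Df Dt.
apply: filterS (ae_family_counts hN Dm Df) => w Nw; apply/funext => m.
rewrite /counts /Defs.count (measure_refinement _ m DB Dt Dm).
under eq_bigr do rewrite Nw.
by rewrite sumEFin/= -natr_sum natrK.
Qed.

Definition pulled_fun (k : {ffun I -> nat}) : X := cylinder_fun f x (pull al k).

Lemma pulled_fun_difference k i : difference pulled_fun k i =
  if al i is Some m then
    (cylinder_fun f x (fun m' => (pull al k m' + (m' == m))%N) -
     cylinder_fun f x (pull al k))%R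
  else 0%R.
Proof.
rewrite /difference /pulled_fun; case im : (al i) => [m|].
  by rewrite (pull_incr _ im).
by rewrite pull_incr_None// subrr.
Qed.

(** Adding a point in a cell of [D] adds one in the set of [B] that contains
    it, and nothing if there is none; so the derivative does not depend on the
    representation. *)
Lemma malliavin_refinement w : counts N B w = pull al (kap D w) ->
  malliavin N B f x w = step_family D (difference pulled_fun (kap D w)).
Proof.
case: dD => _ _ Dt cw; apply/funext => e; rewrite /malliavin cw /step_family.
set c := pull al _.
transitivity (\sum_(m < M) \1_(B m) e *:
    (cylinder_fun f x (fun m' => (c m' + (m' == m))%N) - cylinder_fun f x c))%R.
  rewrite exchange_big/=; apply: eq_bigr => m _.
  rewrite /cylinder_fun -sumrB scaler_sumr; apply: eq_bigr => i _.
  by rewrite -scalerBl !scalerA mulrC.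
rewrite [RHS](bigID (fun i => al i != None))/= [X in (_ + X)%R]big1 ?addr0.
  rewrite big_fibers; apply: eq_bigr => m _.
  rewrite (indic_refinement DB Dt) scaler_suml; apply: eq_bigr => i /eqP im.
  by rewrite pulled_fun_difference im.
by move=> i /negPn/eqP iN; rewrite pulled_fun_difference iN scaler0.
Qed.

End represented.

Definition represented_by (F : Omega -> X) (G : Omega -> V) (n M : nat)
    (B : 'I_M -> set E) (f : 'I_n -> ('I_M -> nat) -> R) (x : 'I_n -> X) :=
  [/\ disjoint_finite mu B,
      {ae P, forall w, F w = cylindrical N B f x w}
    & {ae P, forall w, G w = j (malliavin N B f x w)}].

(** The p-th moment of the norm of the derivative, with both variables
    restricted to the events that the union of [B] has at most [a],
    respectively [b], points.  It is expressed through [B] alone, so that it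
    does not change when [B] is refined together with another family. *)
Definition truncated_moment (M : nat) (B : 'I_M -> set E)
    (Phi : {ffun 'I_M -> nat} -> X) (a b : nat) : \bar R :=
  \int[P]_w ((total_count predT (kap B w) <= a)%N%:R%:E *
    \int[P]_w' ((total_count predT (kap B w') <= b)%N%:R%:E *
      (`|compensated_sum (rate mu B) predT (difference Phi (kap B w))
           (kap B w')| `^ p)%:E)).

Lemma refinement_id (M : nat) (B : 'I_M -> set E) : refinement Some B B.
Proof.
move=> m; apply/seteqP; split => [e Be|e [i /= /eqP[->]]//].
by exists m => /=.
Qed.

Lemma pull_id (M : nat) (k : {ffun 'I_M -> nat}) : pull Some k = k.
Proof.
by apply/funext => m; rewrite /pull (big_pred1 m).
Qed.

(** The truncations are removed by monotone convergence: [b], for the inner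
    variable, after [a]. *)
Lemma integral_normX_le_truncated F G n M (B : 'I_M -> set E)
    (f : 'I_n -> ('I_M -> nat) -> R) (x : 'I_n -> X) (c : \bar R) :
  represented_by F G B f x ->
  (forall a b, truncated_moment B (pulled_fun f x Some) a b <= c) ->
  \int[P]_w (`|G w| `^ p)%:E <= c.
Proof.
move=> [dB _ Ge] hc; have [Bm Bf Bt] := dB.
have mB := discrete_family_counts hN Bm.
pose Q k k' := (`|compensated_sum (rate mu B) predT
  (difference (pulled_fun f x Some) k) k'| `^ p)%:E.
have Q0 k k' : 0 <= Q k k' by rewrite lee_fin powR_ge0.
have mQ k : measurable_fun setT (fun w => Q k (kap B w)).
  exact: measurable_discrete_rv.
apply: (@le_trans _ _ (\int[P]_w \int[P]_w' Q (kap B w) (kap B w'))).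
  apply: ae_le_integral_measurable_ub.
  - by move=> w; rewrite lee_fin powR_ge0.
  - by move=> w; exact: integral_ge0.
  - exact: (measurable_discrete_rv (fun k => \int[P]_w' Q k (kap B w'))).
  - apply: filterS2 Ge (ae_counts_refinement dB (refinement_id B)) => w -> cw.
    rewrite (malliavin_refinement _ _ dB (refinement_id B) cw).
    by rewrite norm_step_family.
pose inner b k := \int[P]_w' ((total_count predT (kap B w') <= b)%N%:R%:E *
  Q k (kap B w')).
have inner0 b k : 0 <= inner b k.
  by apply: integral_ge0 => w' _; rewrite mule_ge0.
have minner b k : measurable_fun setT
    (fun w' => (total_count predT (kap B w') <= b)%N%:R%:E * Q k (kap B w')).
  exact: (measurable_discrete_rv (fun k' =>
    (total_count predT k' <= b)%N%:R%:E * Q k k')).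
apply: (@integral_le_nondecreasing _ _ _ _
  (fun b w => inner b (kap B w))) => //.
- move=> b; exact: measurable_discrete_rv.
- move=> w b b' bb'; apply: ge0_le_integral => //.
  + by move=> w' _; rewrite mule_ge0.
  + by move=> w' _; exact: nondecreasing_truncation.
- move=> w.
  have -> : \int[P]_w' Q (kap B w) (kap B w') =
      \int[P]_w' limn (fun b => (total_count predT (kap B w') <= b)%N%:R%:E *
        Q (kap B w) (kap B w')).
    apply: eq_integral => w' _; apply/esym/cvg_lim => //.
    exact: cvg_truncation.
  apply: cvg_monotone_convergence => //.
  + by move=> b w' _; rewrite mule_ge0.
  + by move=> w' _; exact: nondecreasing_truncation.
- move=> b; apply: (@integral_le_truncation _ _ _ _
    (fun w => total_count predT (kap B w))) => [a||a]//.
    exact: (measurable_discrete_rv (fun k =>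
    (total_count predT k <= a)%N%:R%:E * inner b k)).
  exact: hc.
Qed.

(** The key estimate transported to cylindrical functions with different
    underlying families, by means of a common refinement of these. *)
Lemma truncated_moment_le F G Fn Gn n M (B : 'I_M -> set E)
    (f : 'I_n -> ('I_M -> nat) -> R) (x : 'I_n -> X)
    n' M' (B' : 'I_M' -> set E)
    (f' : 'I_n' -> ('I_M' -> nat) -> R) (x' : 'I_n' -> X) (a b : nat)
    (Lam : R) :
  (\sum_m rate mu B m <= Lam)%R ->
  represented_by Fn Gn B f x -> represented_by F G B' f' x' ->
  truncated_moment B (pulled_fun f x Some) a b <=
  (2 `^ p)%:E * (\int[P]_w (`|(G w - Gn w)%R| `^ p)%:E +
    (2 * (b%:R + Lam + 1) `^ (p - 1) * (2 `^ p * (a.+1%:R + Lam)))%R%:E *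
    \int[P]_w (`|F w| `^ p)%:E).
Proof.
move=> BLam [dB _ Gne] [dB' Fe Ge].
have [I [D [al [be [dD DB DB']]]]] := common_refinement dB dB'.
have [Dm Df Dt] := dD; have [Bm Bf Bt] := dB.
have mD := discrete_family_counts (D := D) hN Dm.
pose Phi := pulled_fun f x al; pose Psi := pulled_fun f' x' be.
pose S i := al i != None.
have rateB m : rate mu B m = (\sum_(i | al i == Some m) rate mu D i)%R.
  rewrite /rate (measure_refinement mu m DB Dt Dm) -sum_fine// => i _.
  by rewrite ge0_fin_numE.
have SLam : (\sum_(i | S i) rate mu D i <= Lam)%R.
  apply: le_trans BLam; rewrite big_fibers.
  by under [leRHS]eq_bigr do rewrite rateB.
have PhiS i : ~~ S i -> forall k, difference Phi k i = 0%R.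
  by move=> /negPn/eqP iN k; rewrite pulled_fun_difference iN.
have := difference_le_of_approx (family_counts_mecke hN Dm Df Dt) (ltW p1)
  Psi a b SLam PhiS.
have -> : \int[P]_w (`|F w| `^ p)%:E = \int[P]_w (`|Psi (kap D w)| `^ p)%:E.
  apply: ae_eq_integral_measurable.
  - by move=> w; rewrite lee_fin powR_ge0.
  - by move=> w; rewrite lee_fin powR_ge0.
  - exact: (measurable_discrete_rv (fun k => (`|Psi k| `^ p)%:E)).
  - apply: filterS2 Fe (ae_counts_refinement dD DB') => w -> cw.
    by rewrite /cylindrical cw.
have -> : \int[P]_w (`|(G w - Gn w)%R| `^ p)%:E =
    \int[P]_w \int[P]_w' (`|compensated_sum (rate mu D) predT
      (fun i => difference Psi (kap D w) i - difference Phi (kap D w) i)%R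
      (kap D w')| `^ p)%:E.
  apply: ae_eq_integral_measurable.
  - by move=> w; rewrite lee_fin powR_ge0.
  - by move=> w; apply: integral_ge0 => w' _; rewrite lee_fin powR_ge0.
  - exact: (measurable_discrete_rv (fun k => \int[P]_w'
      (`|compensated_sum (rate mu D) predT
      (fun i => difference Psi k i - difference Phi k i)%R
      (kap D w')| `^ p)%:E)).
  - have cDB := ae_counts_refinement dD DB.
    have cDB' := ae_counts_refinement dD DB'.
    apply: filterS2 (filterI Ge Gne) (filterI cDB cDB') => w [-> ->] [cw cw'].
    rewrite (malliavin_refinement _ _ dD DB cw).
    by rewrite (malliavin_refinement _ _ dD DB' cw') norm_step_familyB.
apply: le_trans; rewrite le_eqVlt; apply/orP; left; apply/eqP.
have kapB w : counts N B w = pull al (kap D w) ->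
    forall m, kap B w m = pull al (kap D w) m.
  by move=> <- m; rewrite ffunE.
have totalB w : counts N B w = pull al (kap D w) ->
    total_count predT (kap B w) = total_count S (kap D w).
  move=> /kapB kB; rewrite /total_count big_fibers.
  by apply: eq_bigr => m _; rewrite kB.
have sumB w w' : counts N B w = pull al (kap D w) ->
    counts N B w' = pull al (kap D w') ->
    compensated_sum (rate mu B) predT
      (difference (pulled_fun f x Some) (kap B w)) (kap B w') =
    compensated_sum (rate mu D) predT (difference Phi (kap D w)) (kap D w').
  move=> /kapB kB /kapB kB'.
  rewrite /compensated_sum [RHS](bigID S)/= [X in (_ + X)%R]big1 ?addr0.
    rewrite big_fibers; apply: eq_bigr => m _.
    have kBE : (kap B w : 'I_M -> nat) = pull al (kap D w) by apply/funext.
    rewrite pulled_fun_difference pull_id kBE kB' rateB /pull natr_sum -sumrB.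
    rewrite scaler_suml; apply: eq_bigr => i /eqP im.
    by rewrite pulled_fun_difference im.
  by move=> i /negPn/eqP iN; rewrite PhiS ?scaler0// /S iN.
pose q k k' : \bar R := ((total_count S k' <= b)%N%:R *
  `|compensated_sum (rate mu D) predT (difference Phi k) k'| `^ p)%:E.
have q0 k k' : 0 <= q k k' by rewrite lee_fin mulr_ge0// powR_ge0.
apply: ae_eq_integral_measurable.
- move=> w; rewrite mule_ge0//; apply: integral_ge0 => w' _.
  by rewrite mule_ge0// lee_fin powR_ge0.
- by move=> w; rewrite mule_ge0//; exact: integral_ge0.
- exact: (measurable_discrete_rv (fun k => (total_count S k <= a)%N%:R%:E *
    \int[P]_w' q k (kap D w'))).
- apply: filterS (ae_counts_refinement dD DB) => w cw.
  rewrite (totalB w cw); set t := (_%:R)%:E.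
  apply: (congr1 (mule t)); apply: ae_eq_integral_measurable.
  + by move=> w'; rewrite mule_ge0// lee_fin powR_ge0.
  + by move=> w'; exact: q0.
  + exact: (measurable_discrete_rv (q (kap D w))).
  + apply: filterS (ae_counts_refinement dD DB) => w' cw'.
    by rewrite (totalB w' cw') (sumB w w' cw cw') -EFinM.
Qed.

End closability.

(** * Passage to the limit *)

Section closability_limit.
Local Open Scope ereal_scope.
Context d d' (Omega : measurableType d) (E : measurableType d') (R : realType).
Variables (P : probability Omega R) (mu : {measure set E -> \bar R}).
Variable N : R.-ker Omega ~> E.
Hypothesis hN : poisson_random_measure P mu N.
Variables (X : normedModType R) (p : R) (V : completeNormedModType R).
Variable j : (E -> X) -> V.
Hypotheses (p1 : (1 < p)%R) (hj : nu_completion P mu N p j).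

(** For fixed truncations the error term is a constant times the p-th moment of
    [F'], which is made arbitrarily small before the truncations are removed. *)
Lemma integral_normX_le_of_approx (F : Omega -> X) (G : Omega -> V) (c : R) :
  malliavin_graph P mu N p j F G ->
  (forall delta : R, (0 < delta)%R -> exists F' G',
    [/\ malliavin_graph P mu N p j F' G',
        \int[P]_w (`|(G' w - G w)%R| `^ p)%:E <= c%:E &
        \int[P]_w (`|F' w| `^ p)%:E <= delta%:E]) ->
  \int[P]_w (`|G w| `^ p)%:E <= (2 `^ p * c)%:E.
Proof.
move=> [_ _ [n [M [B [f [x repr]]]]]] approx.
apply: (integral_normX_le_truncated hN p1 hj repr) => a b.
pose Lam := (\sum_m rate mu B m)%R.
have Lam0 : (0 <= Lam)%R.
  by apply: sumr_ge0 => m _; apply: fine_ge0.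
set C := (2 * (b%:R + Lam + 1) `^ (p - 1) * (2 `^ p * (a.+1%:R + Lam)))%R.
have C0 : (0 <= C)%R by rewrite !mulr_ge0 ?powR_ge0// addr_ge0.
apply/lee_addgt0Pr => eps eps0.
have C1 : (0 < 2 `^ p * (C + 1))%R by rewrite mulr_gt0 ?powR_gt0// ltr_wpDl.
have delta0 : (0 < eps / (2 `^ p * (C + 1)))%R by rewrite divr_gt0.
have [F' [G' [[_ _ [n' [M' [B' [f' [x' repr']]]]]] Gc Fd]]] := approx _ delta0.
apply: (le_trans (truncated_moment_le hN p1 hj a b (lexx Lam) repr repr')).
apply: (@le_trans _ _
  (2 `^ p * (c + C * (eps / (2 `^ p * (C + 1)))))%R%:E).
  rewrite [X in _ <= X]EFinM; apply: lee_wpmul2l.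
    by rewrite lee_fin powR_ge0.
  rewrite EFinD; apply: leeD => //; rewrite [X in _ <= X]EFinM.
  by apply: lee_wpmul2l; rewrite ?lee_fin.
rewrite -EFinD lee_fin mulrDr lerD2l mulrA [X in (_ <= X)%R](_ : eps =
  (2 `^ p * (C + 1)) * (eps / (2 `^ p * (C + 1))))%R; last first.
  by rewrite mulrC divfK// gt_eqF.
by rewrite ler_wpM2r ?(ltW delta0)// ler_wpM2l ?powR_ge0// lerDl.
Qed.

End closability_limit.

Theorem theorem5p6 (R : realType) (d d' : measure_display)
    (Omega : measurableType d) (P : probability Omega R)
    (E : measurableType d') (mu : {sigma_finite_measure set E -> \bar R})
    (N : R.-ker Omega ~> E) (hN : poisson_random_measure P mu N)
    (X : completeNormedModType R) (p : R) (hp : 1 < p)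
    (V : completeNormedModType R) (j : (E -> X) -> V)
    (hV : nu_completion P mu N p j) :
  closable_Lp P p (malliavin_graph P mu N p j).
Proof.
move=> F G g FG [sg _] F0 Gg.
have p0 : 0 < p by exact: lt_trans hp.
have sG n : strongly_measurable P (G n) by have [_ []] := FG n.
apply: (ae_eq0_of_integral_normX p0 sg) => eps eps0.
have K0 : 0 < 2 `^ p :> R by exact: powR_gt0.
set K := 2 `^ p in K0.
have KK1 : 0 < 1 + K * (K * 2) by rewrite addr_gt0// !mulr_gt0.
have KK0 : 0 < K * (1 + K * (K * 2)) by rewrite mulr_gt0.
pose eta := eps / (K * (1 + K * (K * 2))).
have eta0 : 0 < eta by rewrite divr_gt0.
have Gsmall : \forall n \near \oo,
    (\int[P]_w (`|G n w - g w| `^ p)%:E <= eta%:E)%E.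
  exact: cvg0_bochner_normX p0 eta0 Gg.
have [n Gn] := @filter_ex _ _ _ _ Gsmall.
have GnK : (\int[P]_w (`|G n w| `^ p)%:E <= (K * (K * (eta + eta)))%:E)%E.
  apply: (integral_normX_le_of_approx hN hp hV (FG n)) => delta delta0.
  have Fsmall := cvg0_bochner_normX p0 delta0 F0.
  have [m [Gm Fm]] := @filter_ex _ _ _ _ (filterI Gsmall Fsmall).
  exists (F m), (G m); split => //.
  apply: (le_trans (integral_normBX_triangle p0 (sG m) (sG n) sg)).
  rewrite [leRHS]EFinM; apply: lee_wpmul2l; first by rewrite lee_fin ltW.
  by rewrite EFinD; apply: leeD; [exact: Gm | exact: Gn].
have := integral_normBX_triangle p0 sg (strongly_measurable_cst P 0) (sG n).
under eq_integral do rewrite subr0.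
move=> /le_trans; apply.
under eq_integral do rewrite distrC.
under [X in (_ + X)%E]eq_integral do rewrite sub0r normrN.
apply: (@le_trans _ _ ((K * (eta + K * (K * (eta + eta))))%:E)).
  rewrite [leRHS]EFinM; apply: lee_wpmul2l; first by rewrite lee_fin ltW.
  by rewrite EFinD; apply: leeD; [exact: Gn | exact: GnK].
rewrite lee_fin le_eqVlt; apply/orP; left; apply/eqP.
by rewrite /eta; field; rewrite (gt_eqF KK1) (gt_eqF K0).
Qed.
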